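(* Let $n\ge1$, let $\mathcal{A}=\{a_0,\dots,a_{n+1}\}\subset\mathbb{Z}^n$ be a set of $n+2$ points not contained in an affine hyperplane (dimension $n$, codimension $1$), and let $C=(c_{ij})\in\mathbb{R}^{n\times(n+2)}$ be a matrix of rank $n$ such that the polynomial system $\sum_{j=0}^{n+1}c_{ij}x^{a_j}=0$, $i=1,\dots,n$, has a solution at $\mathbf{1}=(1,\dots,1)$ of multiplicity $n+1$. Then there exists a small perturbation $\tilde C=(\tilde c_{ij})\in\mathbb{R}^{n\times(n+2)}$ of $C$ (that is, in every neighbourhood of $C$ there is such a $\tilde C$) such that the polynomial system $\sum_{j=0}^{n+1}\tilde c_{ij}x^{a_j}=0$, $i=1,\dots,n$, has $n+1$ positive solutions.
   Context: A positive solution is a solution in $(\mathbb{R}_{>0})^n$; the $n+1$ solutions are distinct. The multiplicity of an isolated solution is the complex dimension of the localization at that point of the quotient of the complex Laurent polynomial ring by the ideal generated by the equations. *)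

(* Defs.v *)
From HB Require Import structures.
From mathcomp Require Import all_boot all_order all_algebra finmap.
From mathcomp Require Import all_classical all_reals all_analysis.
From mathcomp Require Import complex ring.

Set Implicit Arguments.
Unset Strict Implicit.
Unset Printing Implicit Defensive.

Import Order.TTheory GRing.Theory Num.Theory.
Import numFieldNormedType.Exports.

Local Open Scope ring_scope.

Definition monomial (F : unitRingType) (n : nat) (x : 'rV[F]_n)
  (k : 'rV[int]_n) : F := \prod_(i < n) x 0 i ^ k 0 i.

Definition in_torus (F : unitRingType) (n : nat) (x : 'rV[F]_n) : bool :=
  [forall i, x 0 i \is a GRing.unit].

Section Monomial.
Variables (F : comUnitRingType) (n : nat) (x : 'rV[F]_n).

Lemma monomial0 : monomial x 0 = 1.
Proof. by rewrite /monomial big1 // => i _; rewrite mxE expr0z. Qed.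

Lemma monomialD : in_torus x ->
  {morph monomial x : k l / k + l >-> k * l}.
Proof.
move=> /forallP xU k l; rewrite /monomial -big_split /=.
by apply: eq_bigr => i _; rewrite mxE exprzDr.
Qed.

End Monomial.

(* The Laurent polynomial ring K[x_1^{+-1}, ..., x_n^{+-1}] as the group
   algebra of Z^n: f k is the coefficient of x^k. *)
Definition laurent (n : nat) (K : fieldType) : Type :=
  {fsfun 'rV[int]_n -> K with 0}.

HB.instance Definition _ (n : nat) (K : fieldType) :=
  Choice.on (laurent n K).

Section LaurentZmod.
Variables (n : nat) (K : fieldType).
Implicit Types (f g : laurent n K) (c d : K) (k l : 'rV[int]_n).

Definition lcoef k f : K := fun_of_fsfun f k.

Definition laurent_zero : laurent n K := [fsfun with 0].
Definition laurent_opp f : laurent n K :=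
  [fsfun k in finsupp f => - lcoef k f].
Definition laurent_add f g : laurent n K :=
  [fsfun k in (finsupp f `|` finsupp g)%fset => lcoef k f + lcoef k g].
Definition laurent_scale c f : laurent n K :=
  [fsfun k in finsupp f => c * lcoef k f].
Definition term c k : laurent n K := [fsfun l in [fset k]%fset => c].

Lemma laurentP f g : (forall k, lcoef k f = lcoef k g) -> f = g.
Proof. by move=> fg; apply/fsfunP. Qed.

Lemma lcoef_supp f k : k \notin finsupp f -> lcoef k f = 0.
Proof. exact: fsfun_dflt. Qed.

Lemma lcoef0E k : lcoef k laurent_zero = 0.
Proof. by rewrite /lcoef fsfunE. Qed.

Lemma lcoefNE k f : lcoef k (laurent_opp f) = - lcoef k f.
Proof.
rewrite {1}/lcoef fsfunE; case: ifPn => // kf.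
by rewrite lcoef_supp ?oppr0.
Qed.

Lemma lcoefDE k f g : lcoef k (laurent_add f g) = lcoef k f + lcoef k g.
Proof.
rewrite {1}/lcoef fsfunE inE; case: ifPn => //; rewrite negb_or => /andP[kf kg].
by rewrite !lcoef_supp ?addr0.
Qed.

Lemma lcoefZE k c f : lcoef k (laurent_scale c f) = c * lcoef k f.
Proof.
rewrite {1}/lcoef fsfunE; case: ifPn => // kf.
by rewrite lcoef_supp ?mulr0.
Qed.

Lemma lcoef_term c k l : lcoef l (term c k) = if l == k then c else 0.
Proof. by rewrite /lcoef fsfunE inE. Qed.

Fact laurent_addA : associative laurent_add.
Proof. by move=> f g h; apply: laurentP => k; rewrite !lcoefDE addrA. Qed.
Fact laurent_addC : commutative laurent_add.
Proof. by move=> f g; apply: laurentP => k; rewrite !lcoefDE addrC. Qed.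
Fact laurent_add0 : left_id laurent_zero laurent_add.
Proof. by move=> f; apply: laurentP => k; rewrite lcoefDE lcoef0E add0r. Qed.
Fact laurent_addN : left_inverse laurent_zero laurent_opp laurent_add.
Proof.
by move=> f; apply: laurentP => k; rewrite lcoefDE lcoefNE lcoef0E addNr.
Qed.

HB.instance Definition _ := GRing.isZmodule.Build (laurent n K)
  laurent_addA laurent_addC laurent_add0 laurent_addN.

Fact lcoef_is_zmod_morphism k : zmod_morphism (lcoef k).
Proof. by move=> f g; rewrite lcoefDE lcoefNE. Qed.
HB.instance Definition _ k :=
  GRing.isZmodMorphism.Build (laurent n K) K (lcoef k)
    (lcoef_is_zmod_morphism k).

Fact laurent_scaleA c d f :
  laurent_scale c (laurent_scale d f) = laurent_scale (c * d) f.
Proof. by apply: laurentP => k; rewrite !lcoefZE mulrA. Qed.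
Fact laurent_scale1 : left_id 1 laurent_scale.
Proof. by move=> f; apply: laurentP => k; rewrite lcoefZE mul1r. Qed.
Fact laurent_scaleDr : right_distributive laurent_scale +%R.
Proof.
by move=> c f g; apply: laurentP => k; rewrite raddfD /= !lcoefZE raddfD mulrDr.
Qed.
Fact laurent_scaleDl f : {morph laurent_scale^~ f : c d / c + d}.
Proof.
by move=> c d; apply: laurentP => k; rewrite raddfD /= !lcoefZE mulrDl.
Qed.

HB.instance Definition _ := GRing.Zmodule_isLmodule.Build K (laurent n K)
  laurent_scaleA laurent_scale1 laurent_scaleDr laurent_scaleDl.

Lemma lcoefZ k c f : lcoef k (c *: f) = c * lcoef k f.
Proof. exact: lcoefZE. Qed.

Lemma termD k : {morph term^~ k : c d / c + d}.
Proof.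
move=> c d; apply: laurentP => l; rewrite raddfD /= !lcoef_term.
by case: ifP => // _; rewrite addr0.
Qed.

Lemma term0 k : term 0 k = 0.
Proof. by apply: laurentP => l; rewrite raddf0 lcoef_term; case: ifP. Qed.

Lemma termZ c d k : c *: term d k = term (c * d) k.
Proof.
by apply: laurentP => l; rewrite lcoefZ !lcoef_term; case: ifP; rewrite ?mulr0.
Qed.

Lemma laurentE f : f = \sum_(k <- finsupp f) term (lcoef k f) k.
Proof.
apply: laurentP => l; rewrite raddf_sum /=.
have [lf|lf] := boolP (l \in finsupp f); last first.
  rewrite lcoef_supp // big_seq big1 // => k kf; rewrite lcoef_term.
  by case: eqP lf => // ->; rewrite kf.
rewrite (bigD1_seq l) ?fset_uniq //= lcoef_term eqxx big1 ?addr0 // => k.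
by rewrite lcoef_term eq_sym => /negPf->.
Qed.

Section Extend.
Variables (V : zmodType) (F : 'rV[int]_n -> K -> V).

Definition extend f : V := \sum_(k <- finsupp f) F k (lcoef k f).

Hypothesis FD : forall k, {morph F k : c d / c + d}.

Let F0 k : F k 0 = 0.
Proof. by apply: (@addrI _ (F k 0)); rewrite -FD !addr0. Qed.

Lemma extend_widen f (D : {fset 'rV[int]_n}) : (finsupp f `<=` D)%fset ->
  extend f = \sum_(k <- D) F k (lcoef k f).
Proof.
move=> fD; rewrite /extend (big_fset_incl _ fD) //= => k _ kf.
by rewrite lcoef_supp.
Qed.

Lemma extend_term c k : extend (term c k) = F k c.
Proof.
rewrite (@extend_widen _ [fset k]%fset).
  by rewrite big_seq_fset1 lcoef_term eqxx.
apply/fsubsetP => l; rewrite mem_finsupp inE; apply: contra_neqT => lk.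
by rewrite -[LHS]/(lcoef l _) lcoef_term (negPf lk).
Qed.

Lemma extendD : {morph extend : f g / f + g}.
Proof.
move=> f g; pose D := (finsupp f `|` finsupp g `|` finsupp (f + g)%R)%fset.
rewrite !(@extend_widen _ D) -?big_split /=.
- by apply: eq_bigr => k _; rewrite raddfD FD.
- by apply/fsubsetP => k kf; rewrite !inE kf ?orbT.
- by apply/fsubsetP => k kf; rewrite !inE kf ?orbT.
- by apply/fsubsetP => k kf; rewrite !inE kf ?orbT.
Qed.

End Extend.

Lemma eq_extend (V : zmodType) (F G : 'rV[int]_n -> K -> V) f :
  (forall k c, F k c = G k c) -> extend F f = extend G f.
Proof. by move=> FG; apply: eq_bigr. Qed.

Lemma eq_on_terms (V : zmodType) (P Q : laurent n K -> V) :
    {morph P : f g / f + g} -> {morph Q : f g / f + g} ->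
  (forall c k, P (term c k) = Q (term c k)) -> P =1 Q.
Proof.
move=> PD QD PQ f; rewrite [f]laurentE.
have P0 : P 0 = 0 by apply: (@addrI _ (P 0)); rewrite -PD !addr0.
have Q0 : Q 0 = 0 by apply: (@addrI _ (Q 0)); rewrite -QD !addr0.
by rewrite (big_morph P PD P0) (big_morph Q QD Q0); apply: eq_bigr.
Qed.

End LaurentZmod.

Section LaurentRing.
Variables (n : nat) (K : fieldType).
Implicit Types (f g : laurent n K) (c d : K) (k l : 'rV[int]_n).

Definition laurent_mul f g : laurent n K :=
  \sum_(k <- finsupp f) \sum_(l <- finsupp g)
     term (lcoef k f * lcoef l g) (k + l).

Let mulF g k c : laurent n K :=
  extend (fun l d => term (c * d) (k + l)) g.

Let mul_extend f g : laurent_mul f g = extend (mulF g) f.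
Proof. by []. Qed.

Let mulFD g k : {morph mulF g k : c d / c + d}.
Proof.
move=> c d; rewrite /mulF /extend -big_split /=; apply: eq_bigr => l _.
by rewrite mulrDl termD.
Qed.

Lemma laurent_mulDl : left_distributive laurent_mul +%R.
Proof. by move=> f g h; rewrite !mul_extend extendD //; apply: mulFD. Qed.

Lemma laurent_mulDr : right_distributive laurent_mul +%R.
Proof.
move=> f g h; rewrite !mul_extend /extend -big_split /=; apply: eq_bigr => k _.
by rewrite /mulF extendD // => l c d; rewrite mulrDr termD.
Qed.

Lemma laurent_mul_term c k d l :
  laurent_mul (term c k) (term d l) = term (c * d) (k + l).
Proof.
rewrite mul_extend extend_term; last exact: mulFD.
by rewrite /mulF extend_term // => m a b; rewrite mulrDr termD.
Qed.

Fact laurent_mulC : commutative laurent_mul.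
Proof.
move=> f g; move: f.
apply: (eq_on_terms (Q := laurent_mul g)) => [f h|f h|c k].
- exact: laurent_mulDl.
- exact: laurent_mulDr.
move: g; apply: (eq_on_terms (P := laurent_mul (term c k))
                             (Q := laurent_mul^~ (term c k))) => [f h|f h|d l].
- exact: laurent_mulDr.
- exact: laurent_mulDl.
- by rewrite !laurent_mul_term mulrC addrC.
Qed.

Fact laurent_mulA : associative laurent_mul.
Proof.
move=> f g h; move: f.
apply: (eq_on_terms (P := laurent_mul^~ (laurent_mul g h))
                    (Q := fun f => laurent_mul (laurent_mul f g) h))
  => [f f'|f f'|c k]; rewrite ?laurent_mulDl //.
move: g; apply: (eq_on_terms
    (P := fun g => laurent_mul (term c k) (laurent_mul g h))
    (Q := fun g => laurent_mul (laurent_mul (term c k) g) h))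
  => [g g'|g g'|d l]; rewrite ?(laurent_mulDl, laurent_mulDr) //.
move: h; apply: (eq_on_terms
    (P := fun h => laurent_mul (term c k) (laurent_mul (term d l) h))
    (Q := fun h => laurent_mul (laurent_mul (term c k) (term d l)) h))
  => [h h'|h h'|e m]; rewrite ?laurent_mulDr //.
by rewrite !laurent_mul_term mulrA addrA.
Qed.

Fact laurent_mul1 : left_id (term 1 0) laurent_mul.
Proof.
apply: (eq_on_terms (Q := id)) => // [f g|c k]; first exact: laurent_mulDr.
by rewrite laurent_mul_term mul1r add0r.
Qed.

Fact laurent_oner_neq0 : term 1 0 != 0 :> laurent n K.
Proof.
apply/eqP => /(congr1 (lcoef 0)); rewrite lcoef_term eqxx raddf0.
by apply/eqP; rewrite oner_eq0.
Qed.

HB.instance Definition _ := GRing.Zmodule_isComNzRing.Build (laurent n K)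
  laurent_mulA laurent_mulC laurent_mul1 laurent_mulDl laurent_oner_neq0.

Fact laurent_scaleAl c f g : c *: (f * g) = (c *: f) * g.
Proof.
move: f; apply: (eq_on_terms (P := fun f => c *: (f * g))
                             (Q := fun f => (c *: f) * g)) => [f h|f h|d k].
- by rewrite mulrDl scalerDr.
- by rewrite scalerDr mulrDl.
move: g; apply: (eq_on_terms (P := fun g => c *: (term d k * g))
                             (Q := fun g => (c *: term d k) * g)) => [f h|f h|e l].
- by rewrite mulrDr scalerDr.
- by rewrite mulrDr.
by rewrite termZ /GRing.mul /= !laurent_mul_term termZ mulrA.
Qed.

HB.instance Definition _ :=
  GRing.Lmodule_isLalgebra.Build K (laurent n K) laurent_scaleAl.
HB.instance Definition _ :=
  GRing.Lalgebra_isComAlgebra.Build K (laurent n K).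

Lemma term_mul c k d l : term c k * term d l = term (c * d) (k + l).
Proof. exact: laurent_mul_term. Qed.

Section Eval.
Variables (x : 'rV[K]_n) (xT : in_torus x).

(* The unused torus hypothesis is what makes leval a ring morphism: at a point
   with a zero coordinate, monomial is not multiplicative. *)
Definition leval of in_torus x := fun f : laurent n K =>
  \sum_(k <- finsupp f) lcoef k f * monomial x k.

Let levalD : {morph leval xT : f g / f + g}.
Proof.
move=> f g; rewrite -![leval xT _]/(extend (fun k c => c * monomial x k) _).
by rewrite extendD // => k c d; rewrite mulrDl.
Qed.

Lemma leval_term c k : leval xT (term c k) = c * monomial x k.
Proof.
rewrite -[LHS]/(extend (fun k c => c * monomial x k) (term c k)).
by rewrite extend_term // => l a b; rewrite mulrDl.
Qed.

Fact leval_is_zmod_morphism : zmod_morphism (leval xT).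
Proof.
move=> f g; apply: (@addIr _ (leval xT g)).
by rewrite -levalD !subrK.
Qed.

HB.instance Definition _ :=
  GRing.isZmodMorphism.Build (laurent n K) K (leval xT) leval_is_zmod_morphism.

Fact leval_is_monoid_morphism : monoid_morphism (leval xT).
Proof.
split; first by rewrite leval_term mul1r monomial0.
move=> f g; move: f; apply: (eq_on_terms (P := fun f => leval xT (f * g))
                          (Q := fun f => leval xT f * leval xT g)).
- by move=> f h; rewrite mulrDl raddfD.
- by move=> f h; rewrite raddfD mulrDl.
move=> c k; move: g; apply: (eq_on_terms
  (P := fun g => leval xT (term c k * g))
  (Q := fun g => leval xT (term c k) * leval xT g)).
- by move=> f h; rewrite mulrDr raddfD.
- by move=> f h; rewrite raddfD mulrDr.
by move=> d l; rewrite term_mul !leval_term monomialD // mulrACA.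
Qed.

HB.instance Definition _ :=
  GRing.isMonoidMorphism.Build (laurent n K) K (leval xT)
    leval_is_monoid_morphism.

End Eval.
End LaurentRing.

(* Prop-valued and possibly improper, unlike ring_quotient.idealr. *)
Record ideal (A : comNzRingType) := Ideal {
  ideal_set :> A -> Prop;
  ideal0 : ideal_set 0;
  idealD : forall f g, ideal_set f -> ideal_set g -> ideal_set (f + g);
  idealM : forall h f, ideal_set f -> ideal_set (h * f)
}.

Section GeneratedIdeal.
Variables (A : comNzRingType) (m : nat) (gen : 'I_m -> A).

Definition gen_ideal_set : set A :=
  [set f | exists h : 'I_m -> A, f = \sum_i h i * gen i]%classic.

Fact gen_ideal0 : gen_ideal_set 0.
Proof. by exists (fun=> 0); rewrite big1 // => i _; rewrite mul0r. Qed.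
Fact gen_idealD f g :
  gen_ideal_set f -> gen_ideal_set g -> gen_ideal_set (f + g).
Proof.
move=> [u ->] [v ->]; exists (fun i => u i + v i).
by rewrite -big_split; apply: eq_bigr => i _; rewrite mulrDl.
Qed.
Fact gen_idealM h f : gen_ideal_set f -> gen_ideal_set (h * f).
Proof.
move=> [u ->]; exists (fun i => h * u i).
by rewrite mulr_sumr; apply: eq_bigr => i _; rewrite mulrA.
Qed.

Definition gen_ideal : ideal A := Ideal gen_ideal0 gen_idealD gen_idealM.

End GeneratedIdeal.

(* The localization of A/I at the K-point ev of A, i.e. at the image of the
   multiplicative set {s | ev s != 0}: fractions f/s, where f/s = g/t iff
   u (f t - g s) = 0 in A/I for some u with ev u != 0.  This is the zero ring
   when I is not contained in the kernel of ev. *)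
Section LocalQuotient.
Variables (K : fieldType) (A : comAlgType K) (I : ideal A).
Variable ev : {rmorphism A -> K}.

Definition frac : Type := {fs : A * A | ev fs.2 != 0}.
HB.instance Definition _ := Choice.on frac.

Definition num (u : frac) : A := (val u).1.
Definition den (u : frac) : A := (val u).2.

Lemma denP (u : frac) : ev (den u) != 0.
Proof. exact: (valP u). Qed.

Definition mkfrac f s (sP : ev s != 0) : frac :=
  exist (fun fs : A * A => ev fs.2 != 0) (f, s) sP.

Fact ev1_neq0 : ev 1 != 0.
Proof. by rewrite rmorph1 oner_eq0. Qed.

Fact evM_neq0 s t : ev s != 0 -> ev t != 0 -> ev (s * t) != 0.
Proof. by move=> sP tP; rewrite rmorphM mulf_neq0. Qed.

Definition frac_eq (u v : frac) : bool :=
  `[< exists2 w, ev w != 0 & I (w * (num u * den v - num v * den u)) >].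

Let idealN f : I f -> I (- f).
Proof. by rewrite -mulN1r; apply: idealM. Qed.

Fact frac_eq_equiv : equiv_class_of frac_eq.
Proof.
split=> [u|u v|v u w].
- apply/asboolP; exists 1; first exact: ev1_neq0.
  by rewrite subrr mulr0; apply: ideal0.
- by apply: asbool_equiv_eq; split=> -[w wP Iw]; exists w => //;
    rewrite -[X in w * X]opprB mulrN; apply: idealN.
move=> /asboolP[a aP Ia] /asboolP[b bP Ib].
apply/asboolP; exists (a * b * den v).
  by do 2?apply: evM_neq0 => //; apply: denP.
have -> : a * b * den v * (num u * den w - num w * den u) =
    (b * den w) * (a * (num u * den v - num v * den u)) +
    (a * den u) * (b * (num v * den w - num w * den v)) by ring.
by apply: idealD; apply: idealM.
Qed.

Canonical frac_eq_canonical := EquivRelPack frac_eq_equiv.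

Canonical frac_eq_encModRel := defaultEncModRel frac_eq.

Definition local_quotient : Type := {eq_quot frac_eq}%qT.
HB.instance Definition _ := Choice.on local_quotient.
HB.instance Definition _ : EqQuotient frac frac_eq local_quotient :=
  EqQuotient.on local_quotient.

Lemma local_quotientP (u v : frac) :
  (exists2 w, ev w != 0 & I (w * (num u * den v - num v * den u))) <->
  (\pi_local_quotient u = \pi_local_quotient v)%qT.
Proof.
split=> [uv|/eqP].
  by apply/eqP; rewrite piE; apply/asboolP.
by rewrite piE => /asboolP.
Qed.

Definition frac_zero : frac := mkfrac 0 ev1_neq0.
Definition frac_one : frac := mkfrac 1 ev1_neq0.
Definition frac_opp (u : frac) : frac := mkfrac (- num u) (denP u).
Definition frac_add (u v : frac) : frac :=
  mkfrac (num u * den v + num v * den u) (evM_neq0 (denP u) (denP v)).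
Definition frac_mul (u v : frac) : frac :=
  mkfrac (num u * num v) (evM_neq0 (denP u) (denP v)).
Definition frac_scale (c : K) (u : frac) : frac :=
  mkfrac (c *: num u) (denP u).

Fact num_mkfrac f s (sP : ev s != 0) : num (mkfrac f sP) = f.
Proof. by []. Qed.
Fact den_mkfrac f s (sP : ev s != 0) : den (mkfrac f sP) = s.
Proof. by []. Qed.

Let fracE := (num_mkfrac, den_mkfrac).

Local Notation "\p" := (\pi_local_quotient)%qT.

Lemma pi_eq (u v : frac) : num u * den v = num v * den u -> \p u = \p v.
Proof.
move=> uv; apply/local_quotientP; exists 1; first exact: ev1_neq0.
by rewrite uv subrr mulr0; apply: ideal0.
Qed.

Lemma pi_opp_eq u u' : \p u = \p u' -> \p (frac_opp u) = \p (frac_opp u').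
Proof.
move=> /local_quotientP[a aP Ia]; apply/local_quotientP; exists a => //; rewrite !fracE.
have -> : a * (- num u * den u' - - num u' * den u) =
  - (a * (num u * den u' - num u' * den u)) by ring.
exact: idealN.
Qed.

Lemma pi_scale_eq c u u' :
  \p u = \p u' -> \p (frac_scale c u) = \p (frac_scale c u').
Proof.
move=> /local_quotientP[a aP Ia]; apply/local_quotientP; exists a => //; rewrite !fracE -!scalerAl -scalerBr -scalerAr -mulr_algl.
exact: idealM.
Qed.

Lemma pi_add_eq u u' v v' : \p u = \p u' -> \p v = \p v' ->
  \p (frac_add u v) = \p (frac_add u' v').
Proof.
move=> /local_quotientP[a aP Ia] /local_quotientP[b bP Ib].
apply/local_quotientP; exists (a * b); first exact: evM_neq0.
rewrite !fracE.
have -> : a * b * ((num u * den v + num v * den u) * (den u' * den v') -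
                   (num u' * den v' + num v' * den u') * (den u * den v)) =
    (b * den v * den v') * (a * (num u * den u' - num u' * den u)) +
    (a * den u * den u') * (b * (num v * den v' - num v' * den v)) by ring.
by apply: idealD; apply: idealM.
Qed.

Lemma pi_mul_eq u u' v v' : \p u = \p u' -> \p v = \p v' ->
  \p (frac_mul u v) = \p (frac_mul u' v').
Proof.
move=> /local_quotientP[a aP Ia] /local_quotientP[b bP Ib].
apply/local_quotientP; exists (a * b); first exact: evM_neq0.
rewrite !fracE.
have -> : a * b * (num u * num v * (den u' * den v') -
                   num u' * num v' * (den u * den v)) =
    (b * num v * den v') * (a * (num u * den u' - num u' * den u)) +
    (a * num u' * den u) * (b * (num v * den v' - num v' * den v)) by ring.
by apply: idealD; apply: idealM.
Qed.

Definition lq_zero : local_quotient := \p frac_zero.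
Definition lq_one : local_quotient := \p frac_one.
Definition lq_opp (x : local_quotient) : local_quotient :=
  \p (frac_opp (repr x)).
Definition lq_add (x y : local_quotient) : local_quotient :=
  \p (frac_add (repr x) (repr y)).
Definition lq_mul (x y : local_quotient) : local_quotient :=
  \p (frac_mul (repr x) (repr y)).
Definition lq_scale c (x : local_quotient) : local_quotient :=
  \p (frac_scale c (repr x)).

Lemma lq_oppE u : lq_opp (\p u) = \p (frac_opp u).
Proof. by apply: pi_opp_eq; rewrite reprK. Qed.
Lemma lq_addE u v : lq_add (\p u) (\p v) = \p (frac_add u v).
Proof. by apply: pi_add_eq; rewrite reprK. Qed.
Lemma lq_mulE u v : lq_mul (\p u) (\p v) = \p (frac_mul u v).
Proof. by apply: pi_mul_eq; rewrite reprK. Qed.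
Lemma lq_scaleE c u : lq_scale c (\p u) = \p (frac_scale c u).
Proof. by apply: pi_scale_eq; rewrite reprK. Qed.

Let lqE := (lq_oppE, lq_addE, lq_mulE, lq_scaleE).

Lemma lq_ind (P : local_quotient -> Prop) :
  (forall u, P (\p u)) -> forall x, P x.
Proof. by move=> Pp x; rewrite -[x]reprK. Qed.

Fact lq_addA : associative lq_add.
Proof.
elim/lq_ind=> u; elim/lq_ind=> v; elim/lq_ind=> w; rewrite !lqE.
by apply: pi_eq; rewrite !fracE; ring.
Qed.
Fact lq_addC : commutative lq_add.
Proof.
elim/lq_ind=> u; elim/lq_ind=> v; rewrite !lqE.
by apply: pi_eq; rewrite !fracE; ring.
Qed.
Fact lq_add0 : left_id lq_zero lq_add.
Proof.
elim/lq_ind=> u; rewrite /lq_zero lq_addE.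
by apply: pi_eq; rewrite !fracE; ring.
Qed.
Fact lq_addN : left_inverse lq_zero lq_opp lq_add.
Proof.
elim/lq_ind=> u; rewrite !lqE.
by apply: pi_eq; rewrite !fracE; ring.
Qed.

HB.instance Definition _ := GRing.isZmodule.Build local_quotient
  lq_addA lq_addC lq_add0 lq_addN.

Lemma piD u v : \p u + \p v = \p (frac_add u v).
Proof. exact: lq_addE. Qed.

Fact lq_mulA : associative lq_mul.
Proof.
elim/lq_ind=> u; elim/lq_ind=> v; elim/lq_ind=> w; rewrite !lqE.
by apply: pi_eq; rewrite !fracE; ring.
Qed.
Fact lq_mulC : commutative lq_mul.
Proof.
elim/lq_ind=> u; elim/lq_ind=> v; rewrite !lqE.
by apply: pi_eq; rewrite !fracE; ring.
Qed.
Fact lq_mul1 : left_id lq_one lq_mul.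
Proof.
elim/lq_ind=> u; rewrite /lq_one lq_mulE.
by apply: pi_eq; rewrite !fracE; ring.
Qed.
Fact lq_mulDl : left_distributive lq_mul +%R.
Proof.
elim/lq_ind=> u; elim/lq_ind=> v; elim/lq_ind=> w; rewrite piD !lqE piD.
by apply: pi_eq; rewrite !fracE; ring.
Qed.

HB.instance Definition _ := GRing.Zmodule_isComPzRing.Build local_quotient
  lq_mulA lq_mulC lq_mul1 lq_mulDl.

Fact lq_scaleA c d x : lq_scale c (lq_scale d x) = lq_scale (c * d) x.
Proof.
elim/lq_ind: x => u; rewrite !lqE.
by apply: pi_eq; rewrite !fracE scalerA.
Qed.
Fact lq_scale1 : left_id 1 lq_scale.
Proof.
by elim/lq_ind=> u; rewrite !lqE; apply: pi_eq; rewrite !fracE scale1r.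
Qed.
Fact lq_scaleDr : right_distributive lq_scale +%R.
Proof.
move=> c; elim/lq_ind=> u; elim/lq_ind=> v; rewrite piD !lqE piD.
by apply: pi_eq; rewrite !fracE scalerDr !scalerAl.
Qed.
Fact lq_scaleDl x : {morph lq_scale^~ x : c d / c + d}.
Proof.
move=> c d; elim/lq_ind: x => u; rewrite !lqE piD.
by apply: pi_eq; rewrite !fracE scalerDl; ring.
Qed.

HB.instance Definition _ := GRing.Zmodule_isLmodule.Build K local_quotient
  lq_scaleA lq_scale1 lq_scaleDr lq_scaleDl.

End LocalQuotient.

Arguments local_quotient {K A} I ev.

Definition has_dimension (K : fieldType) (V : lmodType K) (d : nat) : Prop :=
  exists2 v2r : V -> 'rV[K]_d, linear v2r & bijective v2r.

Section LaurentSystems.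
Variables (R : realType) (n N : nat).
Implicit Types (a : 'I_N -> 'rV[int]_n) (C : 'M[R]_(n, N)) (x : 'rV[R]_n).

Definition in_affine_hyperplane a : Prop :=
  exists (u : 'rV[R]_n) (b : R),
    u != 0 /\ forall j, \sum_(i < n) u 0 i * (a j 0 i)%:~R = b.

Definition solution a C x : Prop :=
  forall i, \sum_(j < N) C i j * monomial x (a j) = 0.

Definition positive_solutions a C : set 'rV[R]_n :=
  [set x : 'rV[R]_n | (forall i, 0 < x 0 i) /\ solution a C x]%classic.

Definition system_poly a C (i : 'I_n) : laurent n R[i] :=
  \sum_(j < N) term (C i j)%:C%C (a j).

Definition complex_point x : 'rV[R[i]]_n := map_mx (real_complex R) x.

(* The coefficients are complexified: the local ring is a quotient of a
   localization of C[x_1^{+-1}, ..., x_n^{+-1}], and m is its dimension over C.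
   Finiteness of this dimension means that x is isolated or not a solution. *)
Definition has_multiplicity a C x (m : nat) : Prop :=
  exists xT : in_torus (complex_point x),
    has_dimension
      (local_quotient (gen_ideal (system_poly a C)) (leval xT)) m.

End LaurentSystems.

(* Main.v *)
Require Import Defs.
From mathcomp Require Import all_boot all_order all_algebra finmap.
From mathcomp Require Import all_classical all_reals all_analysis.
From mathcomp Require Import complex zify ring lra.
Import Order.TTheory GRing.Theory Num.Theory numFieldNormedType.Exports.

Set Implicit Arguments.
Unset Strict Implicit.
Unset Printing Implicit Defensive.

Local Open Scope classical_set_scope.
Local Open Scope ring_scope.

(** Eliminating the unknowns leaves one equation in one real variable, whose
    zeros can be counted and moved.

    Put alpha_j = a_j - a_0 for the n+1 indices j other than 0.  Since 1 is a
    solution, the rows of C sum to zero, so the kernel of C is spanned by the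
    all-one vector and a vector (0, b).  Hence a point x of the torus is a
    solution exactly when x^alpha_j = 1 + t b_j for all j and some scalar t.
    The alpha_j span the space and satisfy one integer relation
    sum_j lambda_j alpha_j = 0; therefore the positive solutions correspond to
    the zeros t of g(t) = sum_j lambda_j ln (1 + t b_j) on the interval where
    all 1 + t b_j are positive ([positive_solutions_curve]).  The derivative of
    g is a polynomial of degree at most n over the product of the 1 + t b_j, so
    by Rolle g has at most n+1 zeros ([log_sum_zeros_bound]).  It remains to
    reach n+1 zeros by moving b.

    The hypothesis on the multiplicity controls the power sums
    p_k = sum_j lambda_j b_j^k.  The local ring at 1 is generated by the
    coordinate t, and t is a root of the polynomial
      F = prod_(lambda_j > 0) (1 + b_j X)^lambda_j
          - prod_(lambda_j < 0) (1 + b_j X)^(- lambda_j),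
    so a dimension n+1 forces X^(n+1) to divide F ([order_of_multiplicity]);
    taking logarithmic derivatives, p_1 = ... = p_n = 0
    ([power_sum_of_order]).  Moreover p_(n+1) is nonzero: otherwise g would
    vanish identically, a curve of solutions would pass through 1 and the local
    ring would have infinite dimension ([curve_infinite_dimension]).  From
    these values the b_j are distinct and nonzero and the lambda_j are nonzero
    ([nodes_nondegenerate]).

    Consequently b |-> (p_1, ..., p_(n+1)) has an invertible Jacobian, of
    Vandermonde type, and successive approximation in R[X] gives polynomials
    B_j with B_j(0) = b_j and prescribed power sums modulo X^(n+2)
    ([lift_power_sums]).  Prescribing p_k(B) = q_k X^(n+1-k) makes the Taylor
    expansion of the logarithm yield, for the function g_e attached to B(e),
      g_e(e tau) = e^(n+1) Q(tau) + O(e^(n+2)),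
    where Q may be any polynomial of degree n+1 that vanishes at 0 and has the
    leading coefficient imposed by p_(n+1) ([log_sum_asymptotic]).  With
    Q = kappa X (X-1) ... (X-n), the sign changes of Q give n+1 zeros of g_e
    for small e > 0 ([near_log_sum_count]).  Finally B(e) is realized by a
    matrix close to C whose kernel is spanned by the all-one vector and
    (0, B(e)) ([tilt_kernel], [near_augment_tilt]). *)

(** * Power sums and logarithmic derivatives *)

Definition power_sum (F : pzRingType) (m : nat) (l b : 'I_m -> F)
    (k : nat) : F :=
  \sum_j l j * b j ^+ k.

(** By linearity: only the top coefficient of q meets a nonzero power sum. *)
Lemma power_sum_horner (F : comNzRingType) (m n : nat) (l b : 'I_m -> F)
    (q : {poly F}) :
  (forall k, (k < n)%N -> power_sum l b k.+1 = 0) -> (size q <= n.+1)%N ->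
  \sum_j l j * b j * q.[b j] = q`_n * power_sum l b n.+1.
Proof.
move=> p0 sq.
have -> : \sum_j l j * b j * q.[b j] =
    \sum_(k < n.+1) q`_k * power_sum l b k.+1.
  under eq_bigr => j _ do rewrite (horner_coef_wide _ sq) mulr_sumr.
  rewrite exchange_big; apply: eq_bigr => k _.
  rewrite /power_sum mulr_sumr; apply: eq_bigr => j _.
  by rewrite exprS; ring.
by rewrite big_ord_recr /= big1 ?add0r // => k _; rewrite p0 ?mulr0.
Qed.

(** Pairing with prod_(i <> j) (X - b_i), which is monic of degree n and
    vanishes at all nodes but b_j, turns the nonzero power sum into the product
    of l_j, b_j and all the differences b_j - b_i. *)
Lemma nodes_nondegenerate (F : fieldType) (n : nat) (l b : 'I_n.+1 -> F) :
  (forall k, (k < n)%N -> power_sum l b k.+1 = 0) ->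
  power_sum l b n.+1 != 0 ->
  injective b /\ forall j, (l j != 0) && (b j != 0).
Proof.
move=> p0 pn.
have key j : l j * b j * \prod_(i < n.+1 | i != j) (b j - b i) != 0.
  pose q : {poly F} := \prod_(i < n.+1 | i != j) ('X - (b i)%:P).
  have sq : size q = n.+1.
    rewrite size_prod => [|i _]; last by rewrite polyXsubC_eq0.
    under eq_bigr => i _ do rewrite size_XsubC.
    rewrite sum_nat_const (cardC1 j) card_ord /=; lia.
  have mq : q \is monic by apply: monic_prod => i _; rewrite monicXsubC.
  have := power_sum_horner p0 (eq_leq sq).
  have -> : q`_n = 1 by move/monicP: mq; rewrite /lead_coef sq.
  rewrite mul1r (bigD1 j) //= big1 ?addr0 => [|i ij]; last first.
    rewrite /q (horner_prod) (bigD1 i) //= hornerXsubC subrr mul0r mulr0 //.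
  rewrite /q horner_prod; under eq_bigr => i _ do rewrite hornerXsubC.
  by move->.
split=> [i j bij|j]; last first.
  by have := key j; rewrite !mulf_eq0 !negb_or => /andP[].
apply/eqP/negPn/negP => ij; have := key j.
by rewrite (bigD1 i) //= bij subrr mul0r mulr0 eqxx.
Qed.

(** On the n+1 nodes, the function 1 / (1 + t x) of x agrees with a
    polynomial of degree at most n, and such a polynomial pairs to zero with
    the vanishing power sums. *)
Lemma log_derivative_eq0 (F : fieldType) (n : nat) (l b : 'I_n.+1 -> F)
    (t : F) :
  (forall k, (k < n.+1)%N -> power_sum l b k.+1 = 0) ->
  (forall j, 1 + t * b j != 0) ->
  \sum_j l j * b j / (1 + t * b j) = 0.
Proof.
move=> p0 tb.
have [t0|t0] := eqVneq t 0.
  apply: etrans (p0 0%N _); last by [].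
  rewrite /power_sum; apply: eq_bigr => j _.
  by rewrite t0 mul0r addr0 divr1 expr1.
(* Modulo h, which vanishes at the nodes, X + 1/t divides the constant h(-1/t);
   the quotient q is, up to a constant factor, the interpolating polynomial. *)
pose h : {poly F} := \prod_i ('X - (b i)%:P).
pose c := h.[- t^-1].
have c0 : c != 0.
  rewrite /c /h horner_prod prodf_seq_neq0; apply/allP => i _ /=.
  rewrite hornerXsubC; have := tb i; apply: contraNneq => /eqP.
  rewrite subr_eq0 => /eqP <-; by rewrite mulrN divff // subrr.
have /factor_theorem[q hq] : root (h - c%:P) (- t^-1).
  by rewrite rootE hornerD hornerN hornerC subrr.
have sq : (size q <= n.+1)%N.
  have sh : size h = n.+2.
    by rewrite size_prod_XsubC /index_enum -enumT size_enum_ord.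
  have shc : size (h - c%:P) = n.+2.
    by rewrite size_polyDl ?sh // size_polyN size_polyC; case: (c != 0).
  have [->|q0] := eqVneq q 0; first by rewrite size_poly0.
  move: shc; rewrite hq size_Mmonic ?monicXsubC // size_XsubC addn2 /=.
  by move=> -[->].
have := power_sum_horner (fun k kn => p0 k (ltn_trans kn (ltnSn n))) sq.
rewrite p0 // mulr0 => e0.
transitivity (- ((\sum_j l j * b j * q.[b j]) / t / c)); last first.
  by rewrite e0 !mul0r oppr0.
rewrite !mulr_suml -sumrN; apply: eq_bigr => j _.
have hj : q.[b j] * (b j + t^-1) = - c.
  have := congr1 (horner^~ (b j)) hq.
  rewrite hornerD hornerN hornerC hornerM hornerXsubC opprK => <-.
  by rewrite /h horner_prod (bigD1 j) //= hornerXsubC subrr mul0r add0r.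
have tj : b j + t^-1 != 0.
  have := tb j; apply: contraNneq => /(congr1 ( *%R t)).
  by rewrite mulr0 mulrDr divff // addrC => ->.
have -> : q.[b j] = - c / (b j + t^-1) by rewrite -hj mulfK.
have e : (1 + t * b j) = t * (b j + t^-1) by rewrite mulrDr divff // addrC.
have e' := tb j; rewrite addrC mulrC in e'.
by field; rewrite ?c0 ?t0 ?e'.
Qed.

Lemma geometric_inverse (F : comNzRingType) (x : F) (n : nat) :
  1 = (1 + x) * (\sum_(k < n) (- x) ^+ k) + (- x) ^+ n.
Proof.
elim: n => [|n IH]; first by rewrite big_ord0 mulr0 add0r expr0.
by rewrite {1}IH big_ord_recr /= exprS; ring.
Qed.

Section LogDerivative.
Variables (F : fieldType) (n m : nat) (b : 'I_m -> F).

Definition linear_factor (j : 'I_m) : {poly F} := 1 + (b j)%:P * 'X.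

Definition cofactor_prod (j : 'I_m) : {poly F} :=
  \prod_(i | i != j) linear_factor i.

Lemma lin_cofactor j :
  linear_factor j * cofactor_prod j = \prod_i linear_factor i.
Proof. by rewrite /cofactor_prod [RHS](bigD1 j). Qed.

Lemma deriv_lin j : (linear_factor j)^`() = (b j)%:P.
Proof.
rewrite /linear_factor derivD derivC add0r derivM derivC derivX.
by rewrite mul0r add0r mulr1.
Qed.

Lemma horner_lin j t : (linear_factor j).[t] = 1 + t * b j.
Proof.
by rewrite /linear_factor hornerD hornerC hornerM hornerC hornerX mulrC.
Qed.

Lemma size_lin j : (size (linear_factor j) <= 2)%N.
Proof.
rewrite /linear_factor (leq_trans (size_polyD _ _)) // geq_max size_poly1 /=.
by rewrite mul_polyC (leq_trans (size_scale_leq _ _)) ?size_polyX.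
Qed.

(** The logarithmic derivative of a product of powers, with denominators
    cleared. *)
Lemma deriv_prod_lin (e : 'I_m -> nat) :
  (\prod_i linear_factor i) * (\prod_i linear_factor i ^+ e i)^`() =
  (\prod_i linear_factor i ^+ e i) *
    \sum_j ((e j)%:R * b j)%:P * cofactor_prod j.
Proof.
pose P := \prod_i linear_factor i; pose W := \prod_i linear_factor i ^+ e i.
pose S (r : seq 'I_m) := \prod_(i <- r) linear_factor i ^+ e i.
suff key (r : seq 'I_m) : P * (S r)^`() =
    S r * \sum_(j <- r) ((e j)%:R * b j)%:P * cofactor_prod j by exact: key.
elim: r => [|j r IH]; first by rewrite /S !big_nil derivC !mulr0.
have one : P * (linear_factor j ^+ e j)^`() =
    linear_factor j ^+ e j * (((e j)%:R * b j)%:P * cofactor_prod j).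
  rewrite deriv_exp deriv_lin /P -(lin_cofactor j).
  case: (e j) => [|k]; first by rewrite mul0r mulr0n !(mulr0, mul0r).
  by rewrite /= -mulr_natr exprS polyCM polyC_natr; ring.
rewrite /S !big_cons -/(S r) derivM mulrDr mulrA one [X in _ + X]mulrCA IH.
ring.
Qed.

Lemma lin_prod_at0 (e : 'I_m -> nat) : (\prod_i linear_factor i ^+ e i).[0] = 1.
Proof.
rewrite horner_prod big1 // => i _.
by rewrite horner_exp horner_lin mul0r addr0 expr1n.
Qed.

(** If two products agree to order n+1 at 0, then their logarithmic
    derivatives agree to order n, and the Taylor coefficients of the difference
    of the latter are, up to sign, the power sums. *)
Lemma power_sum_of_order (c d : 'I_m -> nat) :
  'X^(n.+1) %| \prod_i linear_factor i ^+ c i -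
    \prod_i linear_factor i ^+ d i ->
  forall k, (k < n)%N -> power_sum (fun j => (c j)%:R - (d j)%:R) b k.+1 = 0.
Proof.
set V := \prod_i linear_factor i ^+ c i.
set W := \prod_i linear_factor i ^+ d i.
pose l j : F := (c j)%:R - (d j)%:R.
pose P := \prod_i linear_factor i.
pose N := \sum_j (l j * b j)%:P * cofactor_prod j.
case/dvdpP => q Vq.
have dvdW : 'X^n %| V^`() * W - V * W^`().
  have -> : V^`() * W - V * W^`() = (V - W)^`() * W - (V - W) * W^`().
    by rewrite derivB; ring.
  rewrite Vq derivM derivXn /= exprSr -mulr_natr.
  apply: dvdp_sub; rewrite -?mulrA ; last first.
    by rewrite mulrCA dvdp_mulIl.
  rewrite mulrDl dvdp_add //; first by rewrite -mulrA mulrCA -mulrA dvdp_mulIl.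
  by rewrite -mulrA mulrCA -mulrA dvdp_mulIl.
(* N / P is the difference of the logarithmic derivatives of V and W. *)
have PN : P * (V^`() * W - V * W^`()) = (V * W) * N.
  have NE : N = \sum_j ((c j)%:R * b j)%:P * cofactor_prod j -
                \sum_j ((d j)%:R * b j)%:P * cofactor_prod j.
    rewrite /N -sumrB; apply: eq_bigr => j _.
    by rewrite /l mulrBl polyCB mulrBl.
  transitivity ((P * V^`()) * W - V * (P * W^`())); first by ring.
  by rewrite !deriv_prod_lin NE -/V -/W; ring.
have cop (p : {poly F}) : p.[0] = 1 -> coprimep 'X^n p.
  move=> p1; apply: coprimep_expl; rewrite coprimep_sym.
  by rewrite -['X]subr0 -polyC0 coprimep_XsubC rootE p1 oner_eq0.
have dvdN : 'X^n %| N.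
  rewrite -(Gauss_dvdpr _ (cop (V * W) _)); last first.
    by rewrite hornerM !lin_prod_at0 mulr1.
  by rewrite -PN dvdp_mull.
pose S : {poly F} := \poly_(k < n) ((-1) ^+ k * power_sum l b k.+1).
(* Expand each 1 / (1 + b_j X) as a geometric series truncated at order n. *)
have NS : 'X^n %| N - P * S.
  have -> : N - P * S = \sum_j
      (l j * b j)%:P * cofactor_prod j * (- ((b j)%:P * 'X)) ^+ n.
    rewrite /S poly_def mulr_sumr.
    have -> : \sum_(k < n) P * ((-1) ^+ k * power_sum l b k.+1 *: 'X^k) =
        \sum_j \sum_(k < n) P * ((l j * b j)%:P * (- ((b j)%:P * 'X)) ^+ k).
      rewrite exchange_big; apply: eq_bigr => k _ /=.
      rewrite -mulr_sumr; congr (_ * _).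
      rewrite /power_sum mulr_sumr scaler_suml.
      apply: eq_bigr => j _.
      rewrite [(- (_ * _)) ^+ k]exprNn exprMn -!mul_polyC !polyCM.
      rewrite !polyC_exp polyCN polyC1 [_ ^+ k.+1]exprS.
      move: (_ ^+ k) (_ ^+ k) (_ ^+ k) => u v w; ring.
    rewrite -sumrB; apply: eq_bigr => j _.
    rewrite -mulr_sumr -mulr_sumr /P -(lin_cofactor j).
    have := geometric_inverse ((b j)%:P * 'X : {poly F}) n.
    rewrite -/(linear_factor j); move: (\sum_(k < n) _) (_ ^+ n) => s z e.
    have -> : z = 1 - linear_factor j * s by rewrite {1}e addrC addKr.
    by ring.
  elim/big_ind: _ => [|x y|j _]; rewrite ?dvdp0 //; first exact: dvdp_add.
  by rewrite exprNn exprMn mulrA mulrA dvdp_mull.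
have dvdS : 'X^n %| S.
  rewrite -(Gauss_dvdpr _ (cop P _)); last first.
    by rewrite /P -(lin_prod_at0 (fun=> 1%N)).
  by rewrite -(dvdp_addr _ NS) subrK.
have S0 : S = 0.
  apply/eqP; apply: contraTT dvdS => S0; apply/negP => /dvdp_leq.
  by rewrite size_polyXn => /(_ S0); rewrite leqNgt ltnS size_poly.
move=> k kn; have := coef_poly n (fun k => (-1) ^+ k * power_sum l b k.+1) k.
rewrite -/S S0 coef0 kn => /esym/eqP.
by rewrite mulf_eq0 signr_eq0 => /eqP.
Qed.

Lemma sum_log_derivative (l : 'I_m -> F) (t : F) :
  (forall j, 1 + t * b j != 0) ->
  (\sum_j (l j * b j)%:P * cofactor_prod j).[t] =
  (\prod_i linear_factor i).[t] * \sum_j l j * b j / (1 + t * b j).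
Proof.
move=> tb; rewrite horner_sum mulr_sumr; apply: eq_bigr => j _.
rewrite -(lin_cofactor j) !hornerM hornerC horner_lin.
by field; apply: tb.
Qed.

Lemma size_log_derivative (l : 'I_m -> F) :
  (size (\sum_j (l j * b j)%:P * cofactor_prod j)%R <= m)%N.
Proof.
apply: (leq_trans (size_sum _ _ _)); apply/bigmax_leqP => j _.
rewrite mul_polyC (leq_trans (size_scale_leq _ _)) //.
apply: (leq_trans (size_prod_leq _ _)).
rewrite (cardC1 j) card_ord leq_subLR.
have jm : (0 < m)%N by case: (m) j => [[]|].
apply: (@leq_ltn_trans (\sum_(i < m | i != j) 2)).
  by apply: leq_sum => i _; apply: size_lin.
by rewrite sum_nat_const (cardC1 j) card_ord; lia.
Qed.
End LogDerivative.

(** * Deforming nodes with prescribed power sums *)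

Lemma vandermonde_solve (F : fieldType) (m : nat) (b v : 'I_m -> F) :
  injective b ->
  exists u : 'I_m -> F, forall k : 'I_m, \sum_j b j ^+ k * u j = v k.
Proof.
move=> binj; pose V := Vandermonde m (\row_j b j).
have Vu : V \in unitmx.
  rewrite unitmxE det_Vandermonde unitfE.
  apply/prodf_neq0 => i _; apply/prodf_neq0 => j ij.
  rewrite !mxE subr_eq0; apply: contraTneq ij => /binj->.
  by rewrite ltnn.
exists (fun j => (invmx V *m \col_k v k) j 0) => k.
have := mulKVmx Vu (\col_k v k) => /matrixP/(_ k 0); rewrite !mxE => <-.
by apply: eq_bigr => j _; rewrite !mxE.
Qed.

(** The remainder is kept as a multiple of h^2, so that it disappears modulo
    twice the precision in a Newton step. *)
Lemma exp_first_order (A : comNzRingType) (x h : A) (k : nat) :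
  exists r, (x + h) ^+ k.+1 = x ^+ k.+1 + k.+1%:R * x ^+ k * h + h ^+ 2 * r.
Proof.
elim: k => [|k [r IH]]; first by exists 0; rewrite !expr1 expr0; ring.
exists (k.+1%:R * x ^+ k + r * (x + h)).
by rewrite exprS IH [x ^+ k.+2]exprS [x ^+ k.+1]exprS -[k.+2]addn1 natrD; ring.
Qed.

(** Hensel lifting: the derivative of the power sums at b with respect to the
    nodes is a Vandermonde matrix with columns scaled by l_j and rows by k,
    hence invertible, and each precision can be raised by one. *)
Lemma lift_power_sums (F : numFieldType) (n : nat) (l b : 'I_n.+1 -> F)
    (T : nat -> {poly F}) (M : nat) :
  injective b -> (forall j, l j != 0) ->
  (forall k, (k < n.+1)%N -> (T k).[0] = power_sum l b k.+1) ->
  exists B : 'I_n.+1 -> {poly F}, (forall j, (B j).[0] = b j) /\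
    forall k, (k < n.+1)%N ->
      'X^(M.+1) %| power_sum (fun j => (l j)%:P) B k.+1 - T k.
Proof.
move=> binj l0 T0; elim: M => [|M [B [B0 BT]]].
  exists (fun j => (b j)%:P); split=> [j|k kn]; first by rewrite hornerC.
  rewrite expr1 -['X]subr0 -polyC0 dvdp_XsubCl rootE hornerD hornerN T0 //.
  rewrite horner_sum subr_eq0; apply/eqP/eq_bigr => j _.
  by rewrite hornerM hornerC horner_exp hornerC.
have /fin_all_exists[D DE] (k : 'I_n.+1) : exists D : {poly F},
    power_sum (fun j => (l j)%:P) B k.+1 - T k = D * 'X^(M.+1).
  by apply/dvdpP/BT.
have [u uE] := vandermonde_solve (fun k => - (D k).[0] / k.+1%:R) binj.
exists (fun j => B j + 'X^(M.+1) * (u j / l j)%:P); split=> [j|k kn].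
  by rewrite hornerD hornerM hornerXn expr0n mul0r addr0.
pose k' := Ordinal kn.
have /fin_all_exists[r rE] (j : 'I_n.+1) :=
  exp_first_order (B j) ('X^(M.+1) * (u j / l j)%:P) k.
pose S := \sum_j (l j)%:P * B j ^+ k * (u j / l j)%:P.
have -> : power_sum (fun j => (l j)%:P)
      (fun j => B j + 'X^(M.+1) * (u j / l j)%:P) k.+1 =
    power_sum (fun j => (l j)%:P) B k.+1 + 'X^(M.+1) * (k.+1%:R * S) +
    'X^(M.+1) * 'X^(M.+1) * \sum_j (l j)%:P * ((u j / l j)%:P ^+ 2 * r j).
  rewrite /S /power_sum !mulr_sumr -!big_split; apply: eq_bigr => j _ /=.
  by rewrite rE; ring.
rewrite addrAC [_ - T k]addrAC (DE k') mulrC -mulrDr.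
apply: dvdp_add; last first.
  by rewrite dvdp_mulr // -exprD dvdp_exp2l //; lia.
rewrite ['X^(M.+2)]exprSr dvdp_mul // -['X]subr0 -polyC0 dvdp_XsubCl rootE.
rewrite hornerD hornerM -polyC_natr hornerC horner_sum.
have -> : \sum_j ((l j)%:P * B j ^+ k * (u j / l j)%:P).[0] =
    - (D k').[0] / k.+1%:R.
  rewrite -(uE k'); apply: eq_bigr => j _.
  by rewrite !hornerM !hornerC horner_exp B0 /=; field; apply: l0.
by rewrite mulrCA divff ?pnatr_eq0 // mulr1 subrr.
Qed.

(** * Asymptotics of sums of logarithms *)

Section Analysis.
Variable R : realType.

Lemma mean_value (f df : R -> R) (a b : R) : a < b ->
  (forall x, a <= x <= b -> is_derive x 1 f (df x)) ->
  exists2 c, a < c < b & f b - f a = df c * (b - a).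
Proof.
move=> ab fd.
have [||c] := @MVT R f df a b ab; last first.
- by rewrite in_itv /= => cab ?; exists c.
- apply: derivable_within_continuous => x; rewrite in_itv /= => xab.
  by have [] := fd x xab.
- move=> x; rewrite in_itv /= => /andP[/ltW ax /ltW xb].
  by apply: fd; rewrite ax.
Qed.

Definition ln_taylor (m : nat) (x : R) : R :=
  \sum_(k < m) (-1) ^+ k * x ^+ k.+1 / k.+1%:R.

Definition ln_taylor_poly (m : nat) : {poly R} :=
  \sum_(k < m) ((-1) ^+ k / k.+1%:R) *: 'X^(k.+1).

Lemma horner_ln_taylor m x : (ln_taylor_poly m).[x] = ln_taylor m x.
Proof.
rewrite horner_sum; apply: eq_bigr => k _.
by rewrite hornerZ hornerXn mulrAC.
Qed.

Lemma deriv_ln_taylor m x :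
  (ln_taylor_poly m)^`().[x] = \sum_(k < m) (- x) ^+ k.
Proof.
rewrite raddf_sum horner_sum; apply: eq_bigr => k _.
rewrite /= derivZ derivXn hornerZ hornerMn hornerXn /=.
rewrite -[x ^+ k *+ _]mulr_natr [in RHS]exprNn.
by rewrite mulrA mulrAC divfK ?pnatr_eq0.
Qed.

Lemma is_derive_ln1 (b t : R) : 0 < 1 + t * b ->
  is_derive t 1 (fun t => ln (1 + t * b)) (b / (1 + t * b)).
Proof.
move=> tb.
have h1 : is_derive t 1 (fun t : R => 1 + t * b) b.
  have -> : (fun t : R => 1 + t * b) = horner (1 + b *: 'X).
    by apply/funext => s; rewrite hornerD hornerC hornerZ hornerX mulrC.
  apply: is_derive_eq.
  rewrite derivD derivC derivZ derivX add0r hornerZ hornerC.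
  by rewrite mulr1.
have h2 := is_derive1_ln tb.
have := @is_derive1_comp R (@ln R) (fun t => 1 + t * b) t _ _ h2 h1.
by rewrite /= -[X in is_derive _ _ _ X]/((1 + t * b)^-1 * b) mulrC.
Qed.

(** The error has derivative (-t)^m / (1 + t), at most 2 |t|^m in absolute
    value for |t| <= 1/2; the mean value theorem integrates this bound. *)
Lemma ln_taylor_bound (m : nat) (x : R) : `|x| <= 2^-1 ->
  `|ln (1 + x) - ln_taylor m x| <= 2 * `|x| ^+ m.+1.
Proof.
move=> x2.
pose f t := ln (1 + t) - ln_taylor m t; pose df t : R := (- t) ^+ m / (1 + t).
have fd (t : R) : `|t| <= 2^-1 -> is_derive t 1 f (df t).
  move=> t2; have t0 : 0 < 1 + t by move: t2; rewrite ler_norml => /andP[]; lra.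
  have -> : f = (fun t => ln (1 + t * 1)) - horner (ln_taylor_poly m).
    by apply/funext => s; rewrite /f !fctE horner_ln_taylor mulr1.
  have h := @is_derive_ln1 1 t; rewrite mulr1 in h; have {}h := h t0.
  apply: is_derive_eq; rewrite deriv_ln_taylor /df.
  apply: (mulfI (lt0r_neq0 t0)).
  rewrite mulrBr [in LHS]mul1r divff ?lt0r_neq0 //.
  rewrite [X in X - _](geometric_inverse t m) addrC addKr.
  by rewrite mulrC divfK // lt0r_neq0.
have f0 : f 0 = 0.
  rewrite /f addr0 ln1 /ln_taylor big1 ?subr0 // => k _.
  by rewrite expr0n mulr0 mul0r.
have dfb (t : R) : `|t| <= `|x| -> `|df t| <= 2 * `|x| ^+ m.
  move=> tx; rewrite /df normrM normrX normrN normfV mulrC.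
  have t2 := le_trans tx x2; have t0 : 2^-1 <= 1 + t.
    by move: t2; rewrite ler_norml => /andP[]; lra.
  apply: ler_pM => //; rewrite ?invr_ge0 //; last exact: lerXn2r.
  by rewrite ger0_norm; [rewrite invf_ple ?posrE //; lra|lra].
rewrite exprS mulrCA -/(f x) mulrC.
have [x0|x0|->] := ltgtP x 0; last by rewrite f0 normr0 mulr0.
- have [t|t /andP[xt t0]] := @mean_value f df x 0 x0.
    move=> /andP[xt t0]; apply: fd; apply: le_trans x2.
    by rewrite !ler0_norm ?lerN2 // ltW.
  rewrite f0 !sub0r => /(congr1 Num.norm); rewrite normrN => ->.
  rewrite normrM normrN ler_wpM2r //; apply: dfb.
  by rewrite !ler0_norm ?lerN2 // ltW.
- have [t|t /andP[t0 xt]] := @mean_value f df 0 x x0.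
    move=> /andP[t0 xt]; apply: fd; apply: le_trans x2.
    by rewrite !ger0_norm // ltW.
  rewrite f0 !subr0 => /(congr1 Num.norm) ->.
  rewrite normrM ler_wpM2r //; apply: dfb.
  by rewrite !ger0_norm // ltW.
Qed.

Definition log_sum m (l b : 'I_m -> R) (t : R) : R :=
  \sum_j l j * ln (1 + t * b j).

Lemma is_derive_log_sum m (l b : 'I_m -> R) t : (forall j, 0 < 1 + t * b j) ->
  is_derive t 1 (log_sum l b) (\sum_j l j * b j / (1 + t * b j)).
Proof.
move=> tb.
have -> : log_sum l b =
    \sum_(j < m) (l j \*: (fun t => ln (1 + t * b j)) : R -> R).
  by apply/funext => s; rewrite fct_sumE.
have h j := is_derive_ln1 (tb j).
have h' j := is_deriveZ (l j) (h j).
have := is_derive_sum h'. move=> hh; apply: (is_derive_eq hh).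
apply: eq_bigr => j _.
by rewrite -[LHS]/(l j * (b j / (1 + t * b j))) mulrA.
Qed.

Lemma log_sum0 m (l b : 'I_m -> R) : log_sum l b 0 = 0.
Proof. by rewrite /log_sum big1 // => j _; rewrite mul0r addr0 ln1 mulr0. Qed.

Lemma near_right (P : R -> Prop) :
  (\forall e \near (0 : R), P e) -> \forall e \near (0 : R)^'+, P e.
Proof. by move=> h; apply: cvg_at_right_filter h; exact: cvg_id. Qed.

Lemma near_poly_bound (p : {poly R}) :
  \forall e \near (0 : R)^'+, `|p.[e]| <= `|p.[0]| + 1.
Proof.
apply: near_right.
have /cvgrPdist_le /(_ 1 ltr01) := @continuous_horner R p 0.
apply: filterS => e; rewrite distrC => h.
by rewrite -[p.[e]](subrK p.[0]) addrC (le_trans (ler_normD _ _)) // lerD2l.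
Qed.

(** Chosen so that the k-th term of the expansion of the logarithm, with power
    sum equal to the target at e, contributes exactly e^(n+1) times the
    monomial of degree k+1 of Q. *)
Definition power_sum_target (n : nat) (Q : {poly R}) (k : nat) : {poly R} :=
  ((-1) ^+ k * (k.+1%:R * Q`_k.+1)) *: 'X^(n - k).

(** Expanding each logarithm to order n+1, the Taylor parts combine into the
    power sums of the nodes B_j(e), which the hypothesis prescribes up to
    e^(n+2); the Taylor remainders are of that order as well. *)
Lemma log_sum_asymptotic (n m : nat) (l : 'I_m -> R) (B : 'I_m -> {poly R})
    (Q : {poly R}) (tau : R) :
  (size Q <= n.+2)%N -> Q`_0 = 0 ->
  (forall k, (k < n.+1)%N ->
     'X^(n.+2) %| power_sum (fun j => (l j)%:P) B k.+1 -
       power_sum_target n Q k) ->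
  exists K, \forall e \near (0 : R)^'+,
    `|log_sum l (fun j => (B j).[e]) (e * tau) - e ^+ n.+1 * Q.[tau]|
      <= e ^+ n.+2 * K.
Proof.
move=> sQ Q0 BT.
have /fin_all_exists[D DE] (k : 'I_n.+1) : exists D : {poly R},
    power_sum (fun j => (l j)%:P) B k.+1 - power_sum_target n Q k =
    D * 'X^(n.+2).
  by apply/dvdpP/BT.
pose H := \sum_(k < n.+1)
  ((-1) ^+ k * tau ^+ k.+1 / k.+1%:R) *: ('X^(k.+1) * D k).
pose beta j := `|(B j).[0]| + 1.
exists (`|H.[0]| + 1 + \sum_j `|l j| * (2 * (`|tau| * beta j) ^+ n.+2)).
near=> e.
have e0 : 0 < e by near: e; exact: nbhs_right_gt.
have He : `|H.[e]| <= `|H.[0]| + 1 by near: e; exact: near_poly_bound.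
have Be j : `|(B j).[e]| <= beta j.
  by move: j; near: e; apply: filter_forall => j; exact: near_poly_bound.
have eb j : e * (`|tau| * beta j) <= 2^-1.
  move: j; near: e; apply: filter_forall => j; apply: near_right.
  have h := @continuous_horner R ((`|tau| * beta j) *: 'X) 0.
  have /cvgrPdist_le /(_ 2^-1) := h.
  rewrite invr_gt0 ltr0n => /(_ isT); apply: filterS => s.
  rewrite !hornerZ !hornerX mulr0 sub0r normrN [s * _]mulrC => h'.
  by apply: le_trans h'; exact: ler_norm.
(* Interchanging the sums over nodes and orders makes the power sums appear. *)
have main : \sum_j l j * ln_taylor n.+1 (e * tau * (B j).[e]) =
    e ^+ n.+1 * Q.[tau] + e ^+ n.+2 * H.[e].
  transitivity (\sum_(k < n.+1) (-1) ^+ k * (e * tau) ^+ k.+1 / k.+1%:R *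
      (power_sum (fun j => (l j)%:P) B k.+1).[e]).
    under eq_bigr => j _ do rewrite mulr_sumr.
    rewrite exchange_big; apply: eq_bigr => k _.
    rewrite horner_sum mulr_sumr; apply: eq_bigr => j _.
    by rewrite hornerM hornerC horner_exp [(e * tau * _) ^+ _]exprMn; ring.
  rewrite (horner_coef_wide _ sQ) [\sum_(i < n.+2) _]big_ord_recl /=.
  rewrite Q0 mul0r add0r.
  rewrite horner_sum !mulr_sumr -big_split; apply: eq_bigr => k _ /=.
  rewrite -[power_sum _ _ _](subrK (power_sum_target n Q k)) DE.
  rewrite hornerD hornerM hornerXn !hornerZ hornerM !hornerXn /bump leq0n add1n.
  have -> : e ^+ n.+1 = e ^+ (n - k) * e ^+ k.+1.
    by rewrite -exprD addnS subnK // -ltnS.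
  rewrite exprMn.
  have k0 : k.+1%:R != 0 :> R by rewrite pnatr_eq0.
  have s1 : (-1) ^+ k * (-1) ^+ k = 1 :> R.
    by rewrite -exprMn mulrNN mulr1 expr1n.
  transitivity (((-1) ^+ k * (-1) ^+ k) *
    (e ^+ (n - k) * e ^+ k.+1 * (Q`_k.+1 * tau ^+ k.+1) *
      (k.+1%:R / k.+1%:R)) + e ^+ n.+2 *
    ((-1) ^+ k * tau ^+ k.+1 / k.+1%:R * (e ^+ k.+1 * (D k).[e]))); last first.
    by rewrite s1 divff // mul1r mulr1.
  by ring.
have -> : log_sum l (fun j => (B j).[e]) (e * tau) - e ^+ n.+1 * Q.[tau] =
    e ^+ n.+2 * H.[e] + \sum_j l j * (ln (1 + e * tau * (B j).[e]) -
      ln_taylor n.+1 (e * tau * (B j).[e])).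
  under [in RHS]eq_bigr => j _ do rewrite mulrBr.
  by rewrite sumrB main /log_sum; ring.
rewrite (le_trans (ler_normD _ _)) // mulrDr lerD //.
  rewrite normrM (ger0_norm (exprn_ge0 _ (ltW e0))).
  by rewrite ler_wpM2l // exprn_ge0 // ltW.
rewrite (le_trans (ler_norm_sum _ _ _)) // mulr_sumr ler_sum // => j _.
rewrite normrM [leRHS]mulrCA ler_wpM2l //.
have xb : `|e * tau * (B j).[e]| <= e * (`|tau| * beta j).
  by rewrite !normrM (gtr0_norm e0) mulrA ler_wpM2l // mulr_ge0 // ltW.
apply: le_trans (ln_taylor_bound _ (le_trans xb (eb j))) _.
rewrite [leRHS]mulrCA -exprMn ler_wpM2l // lerXn2r // nnegrE //.
by apply: le_trans xb.
Unshelve. all: by end_near. Qed.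

End Analysis.

(** * Counting zeros of sums of logarithms *)

Section Roots.
Variable R : realType.

Definition log_domain m (b : 'I_m -> R) (t : R) := forall j, 0 < 1 + t * b j.

Lemma log_domain0 m (b : 'I_m -> R) : log_domain b 0.
Proof. by move=> j; rewrite mul0r addr0. Qed.

Lemma log_domain_convex m (b : 'I_m -> R) (s t u : R) :
  log_domain b s -> log_domain b t -> s <= u <= t -> log_domain b u.
Proof.
move=> sb tb /andP[su ut] j; have := sb j; have := tb j.
have [b0|b0] := lerP 0 (b j) => h1 h2.
  by apply: lt_le_trans h2 _; rewrite lerD2l ler_wpM2r.
by apply: lt_le_trans h1 _; rewrite lerD2l ler_wnM2r // ltW.
Qed.

Lemma log_sum_mvt m (l b : 'I_m -> R) (s t : R) : s < t ->
  log_domain b s -> log_domain b t ->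
  exists2 u, (s < u < t) /\ log_domain b u &
    log_sum l b t - log_sum l b s =
      (\sum_j l j * b j / (1 + u * b j)) * (t - s).
Proof.
move=> st sb tb.
have [u ust|u /andP[su ut] e] := mean_value (f := log_sum l b)
  (df := fun u => \sum_j l j * b j / (1 + u * b j)) st.
  by apply: is_derive_log_sum; exact: log_domain_convex ust.
exists u => //; split; first by rewrite su.
by apply: (log_domain_convex sb tb); rewrite !ltW.
Qed.

Lemma increasing_inj m (f : 'I_m -> R) :
  (forall i j : 'I_m, (i < j)%N -> f i < f j) -> injective f.
Proof.
move=> f_lt i j fij.
by have [/f_lt|/f_lt|/val_inj //] := ltngtP i j; rewrite fij ltxx.
Qed.

(** Rolle: between consecutive zeros the derivative vanishes, and its
    numerator is a polynomial of degree at most n.  That numerator is nonzero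
    as soon as the sum of logarithms is not constant. *)
Lemma log_sum_zeros_bound (n : nat) (l b : 'I_n.+1 -> R) (s : seq R) :
  (exists2 t, log_domain b t & log_sum l b t != 0) ->
  uniq s -> {in s, forall t, log_domain b t /\ log_sum l b t = 0} ->
  (size s <= n.+1)%N.
Proof.
move=> [t0 t0b lt0] us sZ; rewrite leqNgt; apply/negP => ss.
pose N : {poly R} := \sum_j (l j * b j)%:P * cofactor_prod b j.
have NE u : log_domain b u -> N.[u] =
    (\prod_i linear_factor b i).[u] * \sum_j l j * b j / (1 + u * b j).
  by move=> ub; apply: sum_log_derivative => j; rewrite lt0r_neq0.
have N0 : N != 0.
  apply: contra_neq lt0 => N0.
  have d0 u : log_domain b u -> \sum_j l j * b j / (1 + u * b j) = 0.
    move=> ub; have := NE _ ub; rewrite N0 horner0 => /esym/eqP.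
    rewrite mulf_eq0 => /orP[|/eqP//]; rewrite horner_prod => /prodf_eq0[i _].
    by rewrite horner_lin gt_eqF.
  have [t0n|t0p|t00] := ltgtP t0 0; last by rewrite t00 log_sum0.
    have [u [_ ub]] := log_sum_mvt l t0n t0b (log_domain0 b).
    by rewrite log_sum0 d0 // mul0r sub0r => /eqP; rewrite oppr_eq0 => /eqP.
  have [u [_ ub]] := log_sum_mvt l t0p (log_domain0 b) t0b.
  by rewrite log_sum0 d0 // mul0r subr0.
pose z i := nth 0 (sort <=%R s) i.
have zs i : (i < n.+2)%N -> z i \in s.
  by move=> i_n; rewrite -(mem_sort <=%R) mem_nth // size_sort (leq_trans i_n).
have zlt i j : (i < j)%N -> (j < n.+2)%N -> z i < z j.
  move=> ij jn; have := lt_sorted_ltn_nth 0 (etrans (sort_lt_sorted s) us).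
  have js := leq_trans jn ss; have is' := ltn_trans ij js.
  by move=> h; rewrite /z h ?inE ?size_sort.
have /fin_all_exists[c cP] (i : 'I_n.+1) :
    exists c, z i < c < z i.+1 /\ root N c.
  have [zb z0] := sZ _ (zs i (ltnW (ltn_ord i))).
  have [zb' z0'] := sZ _ (zs i.+1 (ltn_ord i)).
  have [u [iu ub]] := log_sum_mvt l (zlt i i.+1 (ltnSn _) (ltn_ord i)) zb zb'.
  rewrite z0 z0' subr0 => /esym/eqP.
  rewrite mulf_eq0 subr_eq0 => /orP[/eqP d0|].
    by exists u; split=> //; rewrite rootE NE // d0 mulr0.
  by rewrite gt_eqF // zlt // ltnS ltn_ord.
have clt (i j : 'I_n.+1) : (i < j)%N -> c i < c j.
  move=> ij; have [/andP[_ ci] _] := cP i; have [/andP[cj _] _] := cP j.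
  apply: lt_trans ci (le_lt_trans _ cj).
  move: ij; rewrite leq_eqVlt => /predU1P[->//|ij].
  by rewrite ltW // zlt // ltnW // ltnS.
have cinj := increasing_inj clt.
have := max_poly_roots N0 (rs := map c (enum 'I_n.+1)).
rewrite map_inj_uniq // enum_uniq size_map size_enum_ord ltnNge.
rewrite size_log_derivative.
suff -> : all (root N) [seq c i | i <- enum 'I_n.+1] by move/(_ isT isT).
by apply/allP => _ /mapP[i _ ->]; have [] := cP i.
Qed.

Lemma ivt_sign_change (f : R -> R) (x y : R) : x < y ->
  (forall t, x <= t <= y -> {for t, continuous f}) -> f x * f y < 0 ->
  exists2 t, x < t < y & f t = 0.
Proof.
move=> xy fc fxy.
have [||t] := @IVT R f x y 0 (ltW xy).
- by apply: continuous_in_subspaceT => t; rewrite inE /= in_itv /=; exact: fc.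
- rewrite ge_min le_max; move: fxy.
  have [fx|fx|->] := ltgtP (f x) 0; last by rewrite mul0r ltxx.
    by rewrite nmulr_rlt0 // => /ltW ->; rewrite orbT.
  by rewrite pmulr_rlt0 // => /ltW ->; rewrite orbT.
rewrite in_itv /= => /andP[xt ty] ft; exists t => //.
by rewrite !lt_neqAle xt ty !andbT; apply/andP; split;
  apply: contraTneq fxy => e;
  rewrite ?e ?ft -?e ?ft ?(mulr0, mul0r) ltxx.
Qed.

Lemma near_log_domain m (B : 'I_m -> {poly R}) (T : R) : 0 < T ->
  \forall e \near (0 : R)^'+, forall t, `|t| <= e * T ->
    log_domain (fun j => (B j).[e]) t.
Proof.
move=> T0; pose beta j := `|(B j).[0]| + 1.
near=> e => t te j.
have e0 : 0 < e by near: e; exact: nbhs_right_gt.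
have Be : `|(B j).[e]| <= beta j.
  by move: j; near: e; apply: filter_forall => j; exact: near_poly_bound.
have eb : e * (T * beta j) < 1.
  move: j {Be}; near: e; apply: filter_forall => j.
  have bT : 0 < T * beta j by rewrite mulr_gt0 // ltr_wpDl.
  have : \forall e \near (0 : R)^'+, e < (T * beta j)^-1.
    by apply: nbhs_right_lt; rewrite invr_gt0.
  by apply: filterS => e; rewrite -ltr_pdivlMr // div1r.
have : `|t * (B j).[e]| < 1.
  apply: le_lt_trans eb; rewrite normrM mulrA; exact: ler_pM.
by rewrite ltr_norml => /andP[]; lra.
Unshelve. all: by end_near. Qed.

Lemma sign_of_approx (x q p r : R) : q != 0 -> 0 < p -> r < `|q| ->
  `|x - p * q| <= p * r -> 0 < x * q.
Proof.
move=> q0 p0 rq h.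
have {h} : `|x - p * q| < p * `|q| by apply: le_lt_trans h _; rewrite ltr_pM2l.
rewrite ltr_distl.
have [q_lt0|q_gt0|/eqP] := ltgtP q 0; last by rewrite (negPf q0).
  rewrite ltr0_norm // => /andP[_]; rewrite mulrN subrr.
  by move=> x0; rewrite nmulr_lgt0.
rewrite gtr0_norm // subrr => /andP[x0 _]; exact: mulr_gt0.
Qed.

(** In the asymptotic expansion the main term e^(n+1) Q(tau) dominates. *)
Lemma near_log_sum_sign (n m : nat) (l : 'I_m -> R) (B : 'I_m -> {poly R})
    (Q : {poly R}) (tau : R) :
  (size Q <= n.+2)%N -> Q`_0 = 0 ->
  (forall k, (k < n.+1)%N ->
     'X^(n.+2) %| power_sum (fun j => (l j)%:P) B k.+1 -
       power_sum_target n Q k) ->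
  Q.[tau] != 0 ->
  \forall e \near (0 : R)^'+,
    0 < log_sum l (fun j => (B j).[e]) (e * tau) * Q.[tau].
Proof.
move=> sQ Q0 BT Qt; have [K KP] := log_sum_asymptotic tau sQ Q0 BT.
near=> e.
have e0 : 0 < e by near: e; exact: nbhs_right_gt.
have eK : e * (`|K| + 1) < `|Q.[tau]|.
  rewrite -ltr_pdivlMr ?ltr_wpDl //; near: e; apply: nbhs_right_lt.
  by rewrite divr_gt0 ?normr_gt0 // ltr_wpDl.
have : `|log_sum l (fun j => (B j).[e]) (e * tau) - e ^+ n.+1 * Q.[tau]|
    <= e ^+ n.+2 * K.
  by near: e.
rewrite [e ^+ n.+2]exprSr -mulrA.
apply: sign_of_approx => //; first by rewrite exprn_gt0.
apply: le_lt_trans eK; rewrite ler_pM2l //; have := ler_norm K; lra.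
Unshelve. all: by end_near. Qed.

End Roots.

Section Count.
Variable R : realType.

Definition nat_root_poly (kappa : R) (n : nat) : {poly R} :=
  kappa *: \prod_(i < n.+1) ('X - i%:R%:P).

Lemma size_nat_root_poly kappa n : (size (nat_root_poly kappa n) <= n.+2)%N.
Proof.
apply: leq_trans (size_scale_leq _ _) _.
by rewrite size_prod_XsubC /index_enum -enumT size_enum_ord.
Qed.

Lemma nat_root_poly_coef0 kappa n : (nat_root_poly kappa n)`_0 = 0.
Proof.
rewrite -horner_coef0 hornerZ horner_prod big_ord_recl hornerXsubC.
by rewrite subrr mul0r mulr0.
Qed.

Lemma nat_root_poly_lead kappa n : (nat_root_poly kappa n)`_n.+1 = kappa.
Proof.
rewrite coefZ; set q := \prod_(i < _) _.
have /monicP : q \is monic by apply: monic_prod => i _; exact: monicXsubC.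
rewrite /lead_coef size_prod_XsubC /index_enum -enumT size_enum_ord => ->.
by rewrite mulr1.
Qed.

(** A half-integer is not a root, by parity. *)
Lemma nat_root_poly_half kappa n (m : nat) : kappa != 0 ->
  (nat_root_poly kappa n).[m%:R - 2^-1] != 0.
Proof.
move=> k0; rewrite hornerZ horner_prod mulf_neq0 //.
apply/prodf_neq0 => i _; rewrite hornerXsubC; apply/eqP => h.
have : (m.*2)%:R = (i.*2.+1)%:R :> R.
  by rewrite -[RHS]natr1 -!muln2 !natrM; lra.
move/eqP; rewrite eqr_nat => /eqP /(congr1 odd); by rewrite /= !odd_double.
Qed.

Lemma nat_root_poly_alternates kappa n (m : nat) : kappa != 0 -> (m < n.+1)%N ->
  (nat_root_poly kappa n).[m%:R - 2^-1] *
    (nat_root_poly kappa n).[m.+1%:R - 2^-1] < 0.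
Proof.
move=> k0 mn; set Q := nat_root_poly _ _.
have q0 : Q.[m%:R - 2^-1] != 0 by apply: nat_root_poly_half.
(* Q.[s] and Q.[s + 1] have all their linear factors but one in common. *)
have e : (m%:R - 2^-1 - n%:R) * Q.[m.+1%:R - 2^-1] =
    (m%:R - 2^-1 + 1) * Q.[m%:R - 2^-1].
  rewrite /Q !hornerZ !horner_prod big_ord_recl [in RHS]big_ord_recr /=.
  rewrite !hornerXsubC.
  have -> : \prod_(i < n) ('X - (bump 0 i)%:R%:P).[m.+1%:R - 2^-1] =
      \prod_(i < n) ('X - i%:R%:P).[m%:R - 2^-1] :> R.
    apply: eq_bigr => i _; rewrite !hornerXsubC /bump leq0n add1n.
    by rewrite -[m.+1%:R]natr1 -[i.+1%:R]natr1; ring.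
  by rewrite -natr1; ring.
have mn' : m%:R <= n%:R :> R by rewrite ler_nat -ltnS.
have s0 : m%:R - 2^-1 - n%:R < 0 :> R by lra.
have m0 : 0 <= m%:R :> R by [].
rewrite -(nmulr_rgt0 _ s0) mulrCA e mulrCA -expr2 mulr_gt0 //; first by lra.
by rewrite exprn_even_gt0.
Qed.

(** The values at e (i - 1/2), for i = 0, ..., n+1, alternate in sign, which
    gives n+1 zeros; Rolle excludes any other. *)
Lemma near_log_sum_count (n : nat) (l : 'I_n.+1 -> R) (B : 'I_n.+1 -> {poly R})
    (kappa : R) : kappa != 0 ->
  (forall k, (k < n.+1)%N ->
     'X^(n.+2) %| power_sum (fun j => (l j)%:P) B k.+1 -
       power_sum_target n (nat_root_poly kappa n) k) ->
  \forall e \near (0 : R)^'+,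
    ([set t | log_domain (fun j => (B j).[e]) t /\
              log_sum l (fun j => (B j).[e]) t = 0] #= `I_n.+1)%card.
Proof.
move=> k0 BT; set Q := nat_root_poly kappa n in BT.
pose s (i : nat) : R := i%:R - 2^-1.
(* All the points e (i - 1/2) with i <= n+1 have absolute value at most
   e (n+2). *)
pose domP e :=
  forall t, `|t| <= e * n.+2%:R -> log_domain (fun j => (B j).[e]) t.
near=> e.
have e0 : 0 < e by near: e; exact: nbhs_right_gt.
have sgn (i : 'I_n.+2) : 0 < log_sum l (fun j => (B j).[e]) (e * s i) * Q.[s i].
  move: i; near: e; apply: filter_forall => i.
  apply: (near_log_sum_sign (n := n)) => //.
  - exact: size_nat_root_poly.
  - exact: nat_root_poly_coef0.
  - exact: nat_root_poly_half.
have dom : domP e by near: e; apply: near_log_domain.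
move: sgn dom; rewrite /domP; set b := fun j => (B j).[e]; move=> sgn dom.
have sb i : (i < n.+2)%N -> `|e * s i| <= e * n.+2%:R.
  move=> i_n; rewrite normrM (gtr0_norm e0) ler_pM2l // ler_norml /s.
  have : i%:R <= n.+2%:R :> R by rewrite ler_nat ltnW.
  have : 0 <= i%:R :> R by []. have : 1 <= n.+2%:R :> R by rewrite ler1n.
  by move=> *; apply/andP; split; lra.
have slt i : e * s i < e * s i.+1.
  by rewrite ltr_pM2l // /s -natr1; lra.
have /fin_all_exists[z zP] (i : 'I_n.+1) : exists t, e * s i < t < e * s i.+1 /\
    (log_domain b t /\ log_sum l b t = 0).
  have i1 : (i.+1 < n.+2)%N by exact: (ltn_ord i).
  have d t : e * s i <= t <= e * s i.+1 -> log_domain b t.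
    by apply: log_domain_convex; apply: dom; apply: sb => //; exact: ltnW.
  have [||u tI t0] := @ivt_sign_change _ (log_sum l b) _ _ (slt i).
  - move=> t /d tb; apply/differentiable_continuous/derivable1_diffP.
    by have [] := is_derive_log_sum l tb.
  - have := sgn (widen_ord (leqnSn _) i); have := sgn (Ordinal i1) => /= h1 h2.
    have h3 := nat_root_poly_alternates k0 (ltn_ord i).
    by have := mulr_gt0 h2 h1; rewrite mulrACA nmulr_lgt0.
  - exists u; split=> //; split=> //; apply: d.
    by move/andP: tI => [/ltW -> /ltW ->].
have zlt (i j : 'I_n.+1) : (i < j)%N -> z i < z j.
  move=> ij; have [/andP[_ zi] _] := zP i; have [/andP[zj _] _] := zP j.
  apply: lt_trans zi (le_lt_trans _ zj).
  by rewrite ler_pM2l // /s lerB // ler_nat.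
have zinj := increasing_inj zlt.
have nz : exists2 t, log_domain b t & log_sum l b t != 0.
  exists (e * s 0); first by apply: dom; apply: sb.
  by have := sgn ord0; apply: contraTneq => ->; rewrite mul0r ltxx.
have -> : [set t | log_domain b t /\ log_sum l b t = 0] =
    [set z (inord i) | i in `I_n.+1].
  apply/seteqP; split=> [t tZ|_ [i _ <-]] /=; last by have [] := zP (inord i).
  apply: contrapT => tz.
  pose ts := t :: [seq z i | i <- enum 'I_n.+1].
  have : (size ts <= n.+1)%N.
    apply: (log_sum_zeros_bound nz).
      rewrite /= map_inj_uniq // enum_uniq andbT; apply/negP => /mapP[i _ ti].
      by apply: tz; exists i => //=; rewrite inord_val.
    move=> u; rewrite inE => /predU1P[->//|/mapP[i _ ->]].
    by have [] := zP i.
  by rewrite /= size_map size_enum_ord ltnn.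
apply: inj_card_eq => i j; rewrite !inE /= => i_n jn /zinj /(congr1 val) /=.
by rewrite !inordK.
Unshelve. all: by end_near. Qed.

End Count.

(** * Dimension of a local ring with principal maximal ideal *)

Lemma linear_combination (K : pzRingType) (V W : lmodType K) (f : V -> W) :
  linear f -> forall (m : nat) (c : 'I_m -> K) (x : 'I_m -> V),
  f (\sum_i c i *: x i) = \sum_i c i *: f (x i).
Proof.
move=> f_lin m c x.
have f0 : f 0 = 0.
  by have := f_lin (-1) 0 0; rewrite scaler0 addr0 scaleN1r addNr.
by elim/big_rec2: _ => // i u v _ <-; exact: f_lin.
Qed.

Section LocalRing.
Variables (K : fieldType) (A : comAlgType K) (I : ideal A).
Variable ev : {rmorphism A -> K}.
Hypothesis evZ : forall c f, ev (c *: f) = c * ev f.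

Definition locally_in (f : A) : Prop := exists2 w, ev w != 0 & I (w * f).

Local Notation L := (local_quotient I ev).

Definition to_local (f : A) : L := (\pi_L (mkfrac f (ev1_neq0 ev)))%qT.

Lemma to_localD f g : to_local (f + g) = to_local f + to_local g.
Proof.
by rewrite /to_local piD; apply: pi_eq; rewrite !num_mkfrac !den_mkfrac; ring.
Qed.

Lemma to_localZ c f : to_local (c *: f) = c *: to_local f.
Proof.
rewrite /to_local -[RHS]/(lq_scale c _) lq_scaleE; apply: pi_eq.
by rewrite !num_mkfrac !den_mkfrac.
Qed.

Lemma to_local_sum (T : Type) (r : seq T) (F : T -> A) :
  to_local (\sum_(i <- r) F i) = \sum_(i <- r) to_local (F i).
Proof. by apply: (big_morph _ to_localD). Qed.

Lemma to_local_eq0 f : to_local f = 0 -> locally_in f.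
Proof.
move/local_quotientP => [w w0]; rewrite !num_mkfrac !den_mkfrac => Iw.
by exists w => //; move: Iw; rewrite !mulr1 subr0.
Qed.

(** Subtracting its value from a fraction p / s leaves a fraction that vanishes
    at the point, hence a multiple of y. *)
Lemma principal_step (y p s : A) (s0 : ev s != 0) k :
  (forall f, ev f = 0 -> exists w g, ev w != 0 /\ I (w * f - y * g)) ->
  exists c p' s' (s0' : ev s' != 0),
    (\pi_L (mkfrac (y ^+ k * p) s0))%qT =
    c *: to_local (y ^+ k) + (\pi_L (mkfrac (y ^+ k.+1 * p') s0'))%qT.
Proof.
move=> Hy; pose c := ev p / ev s.
have [|w [g [w0 Iwg]]] := Hy (p - c *: s).
  by rewrite rmorphB evZ /c divfK // subrr.
exists c, g, (w * s), (evM_neq0 w0 s0).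
rewrite -to_localZ /to_local piD; apply/local_quotientP.
exists 1; first exact: ev1_neq0.
rewrite !num_mkfrac !den_mkfrac mul1r !mul1r !mulr1.
have -> : y ^+ k * p * (w * s) - (c *: y ^+ k * (w * s) + y ^+ k.+1 * g) * s =
    (y ^+ k * s) * (w * (p - c *: s) - y * g).
  by rewrite -mulr_algl -[c *: s]mulr_algl exprS; ring.
exact: idealM.
Qed.

Lemma principal_expansion (y : A) (u : L) k :
  (forall f, ev f = 0 -> exists w g, ev w != 0 /\ I (w * f - y * g)) ->
  exists (c : 'I_k -> K) p s (s0 : ev s != 0),
    u = \sum_i c i *: to_local (y ^+ i) + (\pi_L (mkfrac (y ^+ k * p) s0))%qT.
Proof.
move=> Hy; elim: k => [|k [c [p [s [s0 uE]]]]].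
  elim/lq_ind: u => u; exists (fun=> 0), (Defs.num u), (Defs.den u), (denP u).
  rewrite big_ord0 add0r; apply: pi_eq.
  by rewrite !num_mkfrac !den_mkfrac expr0 mul1r.
have [c' [p' [s' [s0' E]]]] := principal_step p s0 k Hy.
exists (fun i : 'I_k.+1 => if unlift ord_max i is Some j then c j else c').
exists p', s', s0'.
rewrite uE E addrA big_ord_recr /= unlift_none; congr (_ + _ + _).
apply: eq_bigr => i _.
suff -> : unlift ord_max (widen_ord (leqnSn k) i) = Some i by [].
rewrite -[RHS](liftK ord_max); congr unlift; apply: val_inj; rewrite /= /bump.
by rewrite leqNgt ltn_ord.
Qed.

(** If the maximal ideal of the local ring is generated by y and y^m = 0, then
    1, y, ..., y^(m-1) span it. *)
Lemma principal_dimension (y : A) (m d : nat) :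
  (forall f, ev f = 0 -> exists w g, ev w != 0 /\ I (w * f - y * g)) ->
  locally_in (y ^+ m) -> has_dimension L d -> (d <= m)%N.
Proof.
move=> Hy [w w0 Iw] [v2r v2r_lin [r2v r2vK v2rK]].
pose M : 'M[K]_(m, d) := \matrix_i v2r (to_local (y ^+ i)).
suff : (1%:M <= M)%MS.
  by move/mxrankS; rewrite mxrank1 => /leq_trans-> //; exact: rank_leq_row.
apply/row_subP => i; rewrite -[row i _]v2rK.
have [c [p [s [s0 ->]]]] := principal_expansion (r2v (row i 1%:M)) m Hy.
have -> : (\pi_L (mkfrac (y ^+ m * p) s0))%qT = 0.
  apply/local_quotientP; exists w => //; rewrite !num_mkfrac !den_mkfrac.
  by rewrite mulr1 mul0r subr0 mulrA [_ * p]mulrC; apply: idealM.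
rewrite addr0 (linear_combination v2r_lin).
apply: summx_sub => j _; apply: scalemx_sub.
by rewrite -[v2r _](rowK (fun i => v2r (to_local (y ^+ i)))) row_sub.
Qed.

(** In a finite-dimensional local ring the powers of y are linearly
    dependent. *)
Lemma dimension_relation (y : A) (d : nat) : has_dimension L d ->
  exists2 q : {poly K}, q != 0 &
    exists2 w, ev w != 0 & I (w * \sum_(i < size q) q`_i *: y ^+ i).
Proof.
move=> [v2r v2r_lin [r2v r2vK v2rK]].
pose M : 'M[K]_(d.+1, d) := \matrix_i v2r (to_local (y ^+ i)).
have : kermx M != 0.
  by rewrite -mxrank_eq0 mxrank_ker subn_eq0 -ltnNge ltnS rank_leq_col.
case/rowV0Pn => c /sub_kermxP cM c0.
pose q : {poly K} := \poly_(i < d.+1) c 0 (inord i).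
have qc (i : 'I_d.+1) : q`_i = c 0 i by rewrite coef_poly ltn_ord inord_val.
exists q.
  apply: contraNneq c0 => q0; apply/eqP/rowP => i.
  by rewrite mxE -qc q0 coef0.
have sq : (size q <= d.+1)%N := size_poly _ _.
have -> : \sum_(i < size q) q`_i *: y ^+ i = \sum_(i < d.+1) c 0 i *: y ^+ i.
  rewrite (big_ord_widen _ (fun i => q`_i *: y ^+ i) sq) big_mkcond.
  apply: eq_bigr => i _; rewrite -qc; case: ltnP => // h.
  by rewrite nth_default // scale0r.
apply: to_local_eq0; rewrite to_local_sum.
apply: (can_inj r2vK).
have -> : v2r 0 = 0.
  have := linear_combination v2r_lin (fun=> 0) (fun=> 0) (m := 0).
  by rewrite !big_ord0.
under eq_bigr => i _ do rewrite to_localZ.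
rewrite (linear_combination v2r_lin) -[RHS]cM mulmx_sum_row.
apply: eq_bigr => i _.
by rewrite rowK.
Qed.

End LocalRing.

(** * The local ring of Laurent polynomials at the point 1 *)

Lemma term1 (n : nat) (K : fieldType) : term 1 0 = 1 :> laurent n K.
Proof. by []. Qed.

Section LaurentPoint.
Variables (n : nat) (K : numFieldType) (x : 'rV[K]_n) (xT : in_torus x).
Hypothesis x1 : x = const_mx 1.
Variable I : ideal (laurent n K).

Lemma leval_scale c f : leval xT (c *: f) = c * leval xT f.
Proof.
rewrite -mulr_algl rmorphM; congr (_ * _).
have -> : c%:A = term c 0 :> laurent n K by rewrite -[1]/(term 1 0) termZ mulr1.
by rewrite /= leval_term monomial0 mulr1.
Qed.

Lemma monomial_one k : monomial x k = 1.
Proof. by rewrite /monomial big1 // => i _; rewrite x1 mxE exp1rz. Qed.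

Variable y : laurent n K.

(** The ideal of Laurent polynomials whose image in the local ring is a
    multiple of y. *)
Definition locally_multiple (f : laurent n K) : Prop :=
  exists w g, leval xT w != 0 /\ I (w * f - y * g).

Lemma locally_multiple_in f : I f -> locally_multiple f.
Proof.
move=> If; exists 1, 0; split; first by rewrite rmorph1 oner_eq0.
by rewrite mul1r mulr0 subr0.
Qed.

Lemma locally_multipleD f g :
  locally_multiple f -> locally_multiple g -> locally_multiple (f + g).
Proof.
move=> [w [u [w0 Iw]]] [w' [u' [w0' Iw']]].
exists (w * w'), (w' * u + w * u'); split; first by rewrite rmorphM mulf_neq0.
have -> : w * w' * (f + g) - y * (w' * u + w * u') =
  w' * (w * f - y * u) + w * (w' * g - y * u') by ring.
by apply: idealD; apply: idealM.
Qed.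

Lemma locally_multipleM h f : locally_multiple f -> locally_multiple (h * f).
Proof.
move=> [w [u [w0 Iw]]]; exists w, (h * u); split=> //.
have -> : w * (h * f) - y * (h * u) = h * (w * f - y * u) by ring.
exact: idealM.
Qed.

Lemma locally_multiple_unit v f :
  leval xT v != 0 -> locally_multiple (v * f) -> locally_multiple f.
Proof.
move=> v0 [w [u [w0 Iw]]]; exists (w * v), u.
by rewrite rmorphM mulf_neq0 // -mulrA.
Qed.

Lemma locally_multiple_y : locally_multiple y.
Proof.
exists 1, 1; rewrite rmorph1 oner_eq0 mulr1 mul1r subrr; split=> //.
exact: ideal0.
Qed.

(** Exponents of the monomials congruent to 1 modulo y in the local ring; they
    form a subgroup, which is saturated by [trivial_exponent_div]. *)
Definition trivial_exponent (k : 'rV[int]_n) := locally_multiple (term 1 k - 1).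

Lemma trivial_exponent0 : trivial_exponent 0.
Proof.
rewrite /trivial_exponent term1 subrr.
by apply: locally_multiple_in; exact: ideal0.
Qed.

Lemma trivial_exponentD k l :
  trivial_exponent k -> trivial_exponent l -> trivial_exponent (k + l).
Proof.
move=> hk hl; rewrite /trivial_exponent.
have -> : term 1 (k + l) - 1 =
    term 1 k * (term 1 l - 1) + (term 1 k - 1) :> laurent n K.
  by rewrite mulrBr mulr1 term_mul mulr1; ring.
by apply: locally_multipleD => //; apply: locally_multipleM.
Qed.

Lemma trivial_exponentN k : trivial_exponent k -> trivial_exponent (- k).
Proof.
move=> hk; rewrite /trivial_exponent.
have -> : term 1 (- k) - 1 = (- term 1 (- k)) * (term 1 k - 1) :> laurent n K.
  rewrite mulNr mulrBr mulr1 term_mul mulr1 addNr term1; ring.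
exact: locally_multipleM.
Qed.

Lemma trivial_exponentMz k (e : int) :
  trivial_exponent k -> trivial_exponent (k *~ e).
Proof.
have nat_case (m : nat) : trivial_exponent k -> trivial_exponent (k *+ m).
  move=> hk; elim: m => [|m IH].
    by rewrite mulr0n; exact: trivial_exponent0.
  by rewrite mulrS; apply: trivial_exponentD.
case: e => m hk; first exact: nat_case.
by rewrite NegzE mulrNz; apply: trivial_exponentN; apply: nat_case.
Qed.

Lemma termX k d : term 1 (k *+ d) = term 1 k ^+ d :> laurent n K.
Proof.
elim: d => [|d IH]; first by rewrite mulr0n expr0.
by rewrite mulrS exprS -IH term_mul mulr1.
Qed.

(** x^(dk) - 1 is x^k - 1 times a sum of d monomials, and that sum takes the
    nonzero value d at the point 1. *)
Lemma trivial_exponent_div k d : (0 < d)%N ->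
  trivial_exponent (k *+ d) -> trivial_exponent k.
Proof.
move=> d0; rewrite /trivial_exponent termX subrX1 mulrC.
apply: locally_multiple_unit; rewrite rmorph_sum /=.
under eq_bigr => i _ do
  rewrite rmorphXn /= leval_term mul1r monomial_one expr1n.
by rewrite sumr_const card_ord pnatr_eq0 -lt0n.
Qed.

(** A Laurent polynomial vanishing at 1 is a combination of the x^k - 1. *)
Lemma locally_multiple_kernel :
  (forall k, trivial_exponent k) ->
  forall f, leval xT f = 0 -> locally_multiple f.
Proof.
move=> hk f f0.
have -> : f = \sum_(k <- finsupp f) lcoef k f *: (term 1 k - 1).
  under eq_bigr => k _ do rewrite scalerBr termZ mulr1.
  rewrite sumrB -[X in X - _]laurentE -scaler_suml.
  suff -> : \sum_(k <- finsupp f) lcoef k f = 0 by rewrite scale0r subr0.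
  rewrite -[RHS]f0 /leval; apply: eq_bigr => k _.
  by rewrite monomial_one mulr1.
elim/big_ind: _ => [|g h|k _].
- by apply: locally_multiple_in; exact: ideal0.
- exact: locally_multipleD.
- by rewrite -mulr_algl; apply: locally_multipleM; exact: hk.
Qed.

End LaurentPoint.

Section Congruence.
Variables (A : comNzRingType) (I : ideal A).

Lemma ideal_sub_prod (m : nat) (e : 'I_m -> nat) (f g : 'I_m -> A) :
  (forall j, I (f j - g j)) -> I (\prod_j f j ^+ e j - \prod_j g j ^+ e j).
Proof.
have mul_sub u v u' v' : I (u - v) -> I (u' - v') -> I (u * u' - v * v').
  move=> h h'; have -> : u * u' - v * v' = u' * (u - v) + v * (u' - v') by ring.
  by apply: idealD; apply: idealM.
have sub_refl u : I (u - u) by rewrite subrr; exact: ideal0.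
move=> fg; elim/big_ind2: _ => [|u v u' v'|j _].
- exact: sub_refl.
- exact: mul_sub.
elim: (e j) => [|k IH]; first exact: sub_refl.
by rewrite !exprS; apply: mul_sub.
Qed.
End Congruence.

Section Multiplicity.
Variables (n m : nat) (K : numFieldType) (x : 'rV[K]_n) (xT : in_torus x).
Hypothesis x1 : x = const_mx 1.
Variables (I : ideal (laurent n K)) (y : laurent n K).
Variables (alpha : 'I_m -> 'rV[int]_n) (b : 'I_m -> K).
Hypothesis relation : forall j, I (term 1 (alpha j) - (1 + b j *: y)).
Hypothesis y0 : leval xT y = 0.
Hypothesis alpha_span : forall k, exists2 d, (0 < d)%N &
  exists e : 'I_m -> int, k *+ d = \sum_j alpha j *~ e j.

Let phi (p : {poly K}) : laurent n K := (map_poly (in_alg (laurent n K)) p).[y].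

(** The relations make every alpha_j a trivial exponent, and every exponent
    has a multiple in the lattice spanned by the alpha_j. *)
Lemma all_locally_multiple f :
  leval xT f = 0 -> locally_multiple xT I y f.
Proof.
apply: (locally_multiple_kernel x1) => k.
have [d d0 [e kd]] := alpha_span k.
apply: (trivial_exponent_div x1 d0); rewrite kd.
elim/big_ind: _ => [|g h|j _].
- exact: trivial_exponent0.
- exact: trivial_exponentD.
apply: trivial_exponentMz; rewrite /trivial_exponent.
have -> : term 1 (alpha j) - 1 =
    (term 1 (alpha j) - (1 + b j *: y)) + (b j)%:A * y.
  by rewrite mulr_algl; ring.
apply: locally_multipleD; first exact: locally_multiple_in.
by apply: locally_multipleM; exact: locally_multiple_y.
Qed.

(** The difference F of the two products vanishes at y in the quotient, because
    the corresponding monomials are equal.  Writing F = X^k q with q(0) nonzero,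
    q(y) is a unit of the local ring, so y^k = 0 and the dimension is at
    most k. *)
Lemma order_of_multiplicity (N : nat) (c d : 'I_m -> nat) :
  \sum_j alpha j *+ c j = \sum_j alpha j *+ d j ->
  has_dimension (local_quotient I (leval xT)) N ->
  'X^N %| \prod_j linear_factor b j ^+ c j - \prod_j linear_factor b j ^+ d j.
Proof.
move=> cd dimL; set F := _ - _.
have phi_lin j : phi (linear_factor b j) = 1 + b j *: y.
  rewrite /phi /linear_factor rmorphD rmorph1 rmorphM /= map_polyC map_polyX.
  by rewrite hornerD hornerC hornerM hornerC hornerX /= mulr_algl.
have phiM p q : phi (p * q) = phi p * phi q by rewrite /phi rmorphM hornerM.
have phi_prod (e : 'I_m -> nat) :
    phi (\prod_j linear_factor b j ^+ e j) = \prod_j (1 + b j *: y) ^+ e j.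
  rewrite /phi rmorph_prod horner_prod; apply: eq_bigr => j _.
  by rewrite rmorphXn horner_exp -phi_lin.
have term_prod (e : 'I_m -> nat) :
    \prod_j term 1 (alpha j) ^+ e j =
    term 1 (\sum_j alpha j *+ e j) :> laurent n K.
  elim/big_rec2: _ => [//|j k f _ ->]; by rewrite -termX term_mul mulr1.
have IF : I (phi F).
  rewrite {1}/phi rmorphB hornerD hornerN -!/(phi _) !phi_prod.
  set P := \prod_j _; set Q := \prod_j _.
  have -> : P - Q = (-1) * (term 1 (\sum_j alpha j *+ c j) - P) +
      (term 1 (\sum_j alpha j *+ d j) - Q) by rewrite cd; ring.
  rewrite -!term_prod.
  by apply: idealD; [apply: idealM|]; exact: ideal_sub_prod.
have [k [q]] := multiplicity_XsubC F 0.
have [-> _ _|F0 /= q0] := eqVneq F 0; first exact: dvdp0.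
rewrite polyC0 subr0 => FE.
suff Nk : (N <= k)%N by rewrite FE dvdp_mull // dvdp_exp2l.
apply: (principal_dimension (y := y) (leval_scale xT)) dimL => [f|].
  by move=> /all_locally_multiple [w [g [w0 Iw]]]; exists w, g.
have qE : leval xT (phi q) = q.[0].
  rewrite /phi -horner_map /= y0 -map_poly_comp; congr horner.
  rewrite map_poly_id // => c' _ /=.
  by rewrite leval_scale rmorph1 mulr1.
exists (phi q); first by rewrite /= qE.
by move: IF; rewrite FE phiM {2}/phi map_polyXn hornerXn.
Qed.
End Multiplicity.

(** * Integer relations between exponents *)

Definition exponent_mx (F : pzRingType) (n m : nat)
    (alpha : 'I_m -> 'rV[int]_n) : 'M[F]_(m, n) :=
  \matrix_(j, i) (alpha j 0 i)%:~R.

Lemma clear_denominators (m : nat) (v : 'I_m -> rat) :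
  exists2 d : nat, (0 < d)%N & exists e : 'I_m -> int,
    forall j, v j * d%:R = (e j)%:~R.
Proof.
have dE j : denq (v j) = `|denq (v j)|%N :> int.
  by rewrite gez0_abs // ltW // denq_gt0.
exists (\prod_j `|denq (v j)|)%N.
  by rewrite prodn_gt0 // => j; rewrite absz_gt0 denq_neq0.
exists (fun j => numq (v j) * (\prod_(i < m | i != j) `|denq (v i)|)%N%:Z) => j.
rewrite (bigD1 j) //= natrM mulrA intrM; congr (_ * _).
by rewrite -[X in _ * X]/((`|denq (v j)|%N : int)%:~R) -dE -numqE.
Qed.

Lemma integer_span (n m : nat) (alpha : 'I_m -> 'rV[int]_n) (k : 'rV[int]_n) :
  \rank (exponent_mx rat alpha) = n ->
  exists2 d, (0 < d)%N & exists e : 'I_m -> int, k *+ d = \sum_j alpha j *~ e j.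
Proof.
move=> rk.
have /row_fullP[B BA] : row_full (exponent_mx rat alpha).
  by rewrite /row_full rk.
pose kq : 'rV[rat]_n := \row_i (k 0 i)%:~R.
have [d d0 [e ve]] := clear_denominators (fun j => (kq *m B) 0 j).
exists d => //; exists e; apply/rowP => i; apply: (@intr_inj rat).
have -> : ((k *+ d) 0 i)%:~R = kq 0 i * d%:R :> rat.
  by rewrite mulmxnE mxE mulr_natr rmorphMn.
rewrite -[kq]mulmx1 -BA mulmxA mxE mulr_suml summxE rmorph_sum.
apply: eq_bigr => j _; rewrite mulrAC ve mxE -scaler_int mxE /=.
by rewrite intrM intz.
Qed.

Lemma integer_relation (n : nat) (alpha : 'I_n.+1 -> 'rV[int]_n) :
  exists2 lam : 'I_n.+1 -> int,
    exists j, lam j != 0 & \sum_j alpha j *~ lam j = 0.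
Proof.
have : kermx (exponent_mx rat alpha) != 0.
  by rewrite -mxrank_eq0 mxrank_ker subn_eq0 -ltnNge ltnS rank_leq_col.
case/rowV0Pn => c /sub_kermxP cM /rV0Pn[j cj].
have [d d0 [e ve]] := clear_denominators (fun j => c 0 j).
have dq : d%:R != 0 :> rat by rewrite pnatr_eq0 -lt0n.
exists e.
  exists j; rewrite -(@intr_eq0 rat) -ve mulf_neq0 //.
apply/rowP => i; apply: (@intr_inj rat); rewrite mxE summxE rmorph_sum /=.
have /rowP/(_ i) := cM; rewrite !mxE => /(congr1 ( *%R^~ d%:R)).
rewrite mul0r => e0; apply: etrans e0; rewrite mulr_suml; apply: eq_bigr => k _.
by rewrite mulrAC ve mxE -scaler_int mxE intrM intz.
Qed.

(** * Positive points with prescribed monomials *)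

Section Parametrization.
Variables (R : realType) (n : nat) (alpha : 'I_n.+1 -> 'rV[int]_n).
Variable lam : 'I_n.+1 -> int.
Local Notation E := (exponent_mx R alpha).
Hypothesis rkE : \rank E = n.
Hypothesis lam_neq0 : exists j, lam j != 0.
Hypothesis lam_rel : \sum_j alpha j *~ lam j = 0.

Definition real_weights (j : 'I_n.+1) : R := (lam j)%:~R.

Lemma rank_exponent_rat : \rank (exponent_mx rat alpha) = n.
Proof.
rewrite -[RHS]rkE -(mxrank_map (ratr : {rmorphism rat -> R})); congr mxrank.
by apply/matrixP => j i; rewrite !mxE /= ratr_int.
Qed.

Lemma weights_annihilate i : \sum_j real_weights j * E j i = 0.
Proof.
have := congr1 (fun v : 'rV[int]_n => (v 0 i)%:~R : R) lam_rel.
rewrite summxE rmorph_sum /= mxE => e0; apply: etrans e0; apply: eq_bigr => j _.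
by rewrite !mxE -[alpha j *~ lam j]scaler_int mxE intrM intz.
Qed.

(** The left kernel has dimension one and contains the integer relation. *)
Lemma left_kernel_exponent (v : 'rV[R]_n.+1) :
  v *m E = 0 -> exists mu, forall j, v 0 j = mu * real_weights j.
Proof.
move=> vE; pose L : 'rV[R]_n.+1 := \row_j real_weights j.
have LE : (L <= kermx E)%MS.
  apply/sub_kermxP/rowP => i; rewrite !mxE -[RHS](weights_annihilate i).
  by apply: eq_bigr => j _; rewrite mxE.
have L0 : L != 0.
  have [j lj] := lam_neq0; apply/rV0Pn; exists j.
  by rewrite mxE intr_eq0.
have : (kermx E <= L)%MS.
  have [_ <-] := mxrank_leqif_sup LE.
  by rewrite mxrank_ker rkE subSnn rank_rV L0.
move=> h; have /sub_rVP[mu vmu] : (v <= L)%MS.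
  by apply: submx_trans h; apply/sub_kermxP.
by exists mu => j; rewrite vmu !mxE.
Qed.

Lemma exprz_exp (x : R) (e : int) : expR x ^ e = expR (x * e%:~R).
Proof.
case: e => m; first by rewrite -exprnP mulrC expRM_natl.
by rewrite NegzE -exprnN mulrNz -pmulrn mulrN expRN mulrC expRM_natl.
Qed.

Lemma monomial_exp (xi : 'I_n -> R) k :
  monomial (\row_i expR (xi i)) k = expR (\sum_i xi i * (k 0 i)%:~R).
Proof.
rewrite /monomial expR_sum; apply: eq_bigr => i _.
by rewrite mxE exprz_exp.
Qed.

Definition exponent_inverse : 'M[R]_(n, n.+1) := pinvmx E.

Lemma exponent_inverseK : exponent_inverse *m E = 1%:M.
Proof. by apply: mulVpmx; rewrite /row_full rkE. Qed.

Definition log_point (b : 'I_n.+1 -> R) (t : R) (i : 'I_n) : R :=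
  \sum_j exponent_inverse i j * ln (1 + t * b j).

Definition curve_point (b : 'I_n.+1 -> R) (t : R) : 'rV[R]_n :=
  \row_i expR (log_point b t i).

Lemma curve_point_gt0 b t i : 0 < curve_point b t 0 i.
Proof. by rewrite mxE expR_gt0. Qed.

(** The vector of the ln (1 + t b_j) is orthogonal to the relation, hence in the
    column space of the exponent matrix, where the left inverse recovers its
    preimage. *)
Lemma monomial_curve_point b t j :
  log_domain b t -> log_sum real_weights b t = 0 ->
  monomial (curve_point b t) (alpha j) = 1 + t * b j.
Proof.
move=> tb gt0; rewrite monomial_exp -[RHS]lnK ?posrE //; congr expR.
pose v : 'cV[R]_n.+1 := \col_j ln (1 + t * b j).
have [|mu muE] :=
  @left_kernel_exponent (row j (1%:M - E *m exponent_inverse)) _.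
  rewrite -row_mul mulmxBl mul1mx -mulmxA exponent_inverseK mulmx1.
  by rewrite subrr row0.
have : (row j (1%:M - E *m exponent_inverse) *m v) 0 0 = 0.
  rewrite mxE -[RHS](mulr0 mu) -[in RHS]gt0 /log_sum mulr_sumr.
  by apply: eq_bigr => k _; rewrite muE mxE mulrA.
rewrite -row_mul mulmxBl mul1mx -mulmxA.
rewrite !mxE => /eqP; rewrite subr_eq0 => /eqP ->.
apply: eq_bigr => i _; rewrite mxE mulrC; congr (_ * _).
by rewrite mxE; apply: eq_bigr => k _; rewrite [v _ _]mxE.
Qed.

(** Take logarithms: the exponent matrix has full column rank, so it determines
    ln x, and the relation annihilates its image. *)
Lemma positive_monomials (b : 'I_n.+1 -> R) (t : R) (x : 'rV[R]_n) :
  (forall i, 0 < x 0 i) -> (forall j, monomial x (alpha j) = 1 + t * b j) ->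
  [/\ log_domain b t, log_sum real_weights b t = 0 & x = curve_point b t].
Proof.
move=> x0 xt.
have xE : x = \row_i expR (ln (x 0 i)).
  by apply/rowP => i; rewrite mxE lnK // posrE.
have tb : log_domain b t.
  by move=> j; rewrite -xt xE monomial_exp expR_gt0.
have lnE j : ln (1 + t * b j) = \sum_i ln (x 0 i) * E j i.
  rewrite -xt xE monomial_exp expRK; apply: eq_bigr => i _.
  by rewrite !mxE expRK.
split=> //.
  rewrite /log_sum; under eq_bigr => j _ do rewrite lnE mulr_sumr.
  rewrite exchange_big big1 // => i _ /=.
  under eq_bigr => j _ do rewrite mulrCA.
  by rewrite -mulr_sumr weights_annihilate mulr0.
rewrite {1}xE; apply/rowP => i; rewrite !mxE; congr expR.
rewrite /log_point; under eq_bigr => j _ do rewrite lnE.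
pose v : 'cV[R]_n := \col_i ln (x 0 i).
have -> : ln (x 0 i) = (exponent_inverse *m (E *m v)) i 0.
  by rewrite mulmxA exponent_inverseK mul1mx mxE.
rewrite mxE; apply: eq_bigr => j _; congr (_ * _); rewrite mxE.
by apply: eq_bigr => k _; rewrite [v _ _]mxE mulrC.
Qed.

Lemma curve_point_inj (b : 'I_n.+1 -> R) j : b j != 0 ->
  {in [set t | log_domain b t /\ log_sum real_weights b t = 0] &,
    injective (curve_point b)}.
Proof.
move=> bj s t; rewrite !inE => -[sb s0] [tb t0] st.
have := monomial_curve_point j sb s0; rewrite st monomial_curve_point //.
by move/addrI/(mulIf bj).
Qed.
End Parametrization.

(** * Matrices with vanishing row sums *)

Section Augment.
Variables (F : fieldType) (n m : nat).

Definition augment (M : 'M[F]_(n, m)) : 'M[F]_(n, m.+1) :=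
  \matrix_(i, j) if unlift ord0 j is Some k then M i k else - \sum_k M i k.

Lemma augment_ord0 M i : augment M i ord0 = - \sum_k M i k.
Proof. by rewrite mxE unlift_none. Qed.

Lemma augment_lift M i k : augment M i (lift ord0 k) = M i k.
Proof. by rewrite mxE liftK. Qed.

Lemma augment_col' (C : 'M[F]_(n, m.+1)) :
  (forall i, \sum_j C i j = 0) -> C = augment (col' ord0 C).
Proof.
move=> C0; apply/matrixP => i j; rewrite mxE.
case: unliftP => [k ->|->]; first by rewrite mxE.
have /eqP := C0 i; rewrite big_ord_recl addr_eq0 => /eqP ->.
by congr (- _); apply: eq_bigr => k _; rewrite mxE.
Qed.
End Augment.

Lemma rank_augment (F : fieldType) (n m : nat) (M : 'M[F]_(n, m)) :
  (\rank (augment M) <= \rank M)%N.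
Proof.
suff -> : augment M = M *m augment 1%:M by exact: mxrankM_maxl.
apply/matrixP => i j; rewrite [RHS]mxE; case: (unliftP ord0 j) => [k ->|->].
  rewrite augment_lift (bigD1 k) //= augment_lift mxE eqxx mulr1.
  rewrite big1 ?addr0 // => l.
  by rewrite augment_lift mxE => /negPf ->; rewrite mulr0.
rewrite augment_ord0 -sumrN; apply: eq_bigr => k _.
rewrite augment_ord0 (bigD1 k) //=.
rewrite mxE eqxx big1 ?addr0 ?mulrN1 // => l.
by rewrite mxE eq_sym => /negPf ->.
Qed.

(** The row space of M is the annihilator of the kernel vector b, so the
    projector along b factors through M; D is the factor. *)
Lemma kernel_line (F : fieldType) (n : nat) (M : 'M[F]_(n, n.+1)) :
  \rank M = n ->
  exists (b : 'cV[F]_n.+1) (w : 'rV[F]_n.+1) (D : 'M[F]_(n.+1, n)),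
    [/\ M *m b = 0, w *m b = 1%:M & D *m M = 1%:M - b *m w].
Proof.
move=> rM.
have : kermx M^T != 0.
  by rewrite -mxrank_eq0 mxrank_ker mxrank_tr rM subSnn.
case/rowV0Pn => c /sub_kermxP cM c0.
have Mb : M *m c^T = 0 by rewrite -[M]trmxK -trmx_mul cM trmx0.
have [j cj] := rV0Pn _ c0.
pose w : 'rV[F]_n.+1 := (c 0 j)^-1 *: delta_mx 0 j.
have wb : w *m c^T = 1%:M.
  apply/rowP => i; rewrite ord1 -scalemxAl -rowE !mxE eqxx mulVf //.
have kM : (kermx (c^T) <= M)%MS.
  have Mk : (M <= kermx (c^T))%MS by apply/sub_kermxP.
  have [_ <-] := mxrank_leqif_sup Mk.
  by rewrite mxrank_ker mxrank_tr rank_rV c0 rM subn1.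
have /submxP[D DE] : (1%:M - c^T *m w <= M)%MS.
  apply: submx_trans kM; apply/sub_kermxP.
  by rewrite mulmxBl mul1mx -mulmxA wb mulmx1 subrr.
by exists c^T, w, D.
Qed.

(** Up to the scalar w beta, this is M composed with the projector along beta
    onto the kernel of w.  Multiplying by w beta avoids a denominator, so that
    the entries are polynomial in beta. *)
Definition tilt (F : fieldType) (n m : nat) (M : 'M[F]_(n, m)) (w : 'rV[F]_m)
    (beta : 'cV[F]_m) : 'M[F]_(n, m) :=
  (w *m beta) 0 0 *: M - (M *m beta) *m w.

Lemma tilt_kernel (F : fieldType) (n : nat) (M : 'M[F]_(n, n.+1))
    (b : 'cV[F]_n.+1) (w : 'rV[F]_n.+1) (D : 'M[F]_(n.+1, n))
    (beta v : 'cV[F]_n.+1) :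
  M *m b = 0 -> w *m b = 1%:M -> D *m M = 1%:M - b *m w ->
  (w *m beta) 0 0 != 0 ->
  tilt M w beta *m v = 0 <-> exists t, v = t *: beta.
Proof.
move=> Mb wb DM wbeta0.
have wvE := mx11_scalar (w *m v); have wbE := mx11_scalar (w *m beta).
set r := (w *m v) 0 0 in wvE *; set s := (w *m beta) 0 0 in wbE wbeta0 *.
have -> : tilt M w beta *m v = M *m (s *: v - r *: beta).
  rewrite /tilt mulmxBl -scalemxAl -[X in _ - X]mulmxA wvE mul_mx_scalar.
  by rewrite mulmxBr -!scalemxAr.
split=> [h|[t vt]]; last first.
  have -> : r = t * s by rewrite /r vt -scalemxAr mxE.
  by rewrite vt scalerA mulrC subrr mulmx0.
set u := _ - _ in h.
have u0 : u = 0.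
  have wu : w *m u = 0.
    by rewrite /u mulmxBr -!scalemxAr wvE wbE !scale_scalar_mx mulrC subrr.
  have := congr1 (mulmx^~ u) DM.
  rewrite -mulmxA h mulmx0 mulmxBl mul1mx -mulmxA.
  by rewrite wu mulmx0 subr0.
exists (r / s).
move/eqP: u0; rewrite subr_eq0 => /eqP /(congr1 (fun z => s^-1 *: z)).
by rewrite !scalerA mulVf // scale1r mulrC.
Qed.

Lemma tilt_base (F : fieldType) (n m : nat) (M : 'M[F]_(n, m))
    (b : 'cV[F]_m) (w : 'rV[F]_m) :
  M *m b = 0 -> w *m b = 1%:M -> tilt M w b = M.
Proof. by move=> Mb wb; rewrite /tilt Mb wb mul0mx subr0 mxE scale1r. Qed.

(** * The system in terms of exponent differences *)

Definition differences (n m : nat) (a : 'I_m.+1 -> 'rV[int]_n) (k : 'I_m) :=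
  a (lift ord0 k) - a ord0.

(** A vector orthogonal to all the differences would be constant on the points
    a_j, so that they would lie on a hyperplane. *)
Lemma rank_differences (R : realType) (n m : nat) (a : 'I_m.+1 -> 'rV[int]_n) :
  ~ in_affine_hyperplane R a -> \rank (exponent_mx R (differences a)) = n.
Proof.
move=> hA; rewrite -mxrank_tr; apply/eqP; rewrite -/(row_free _) -kermx_eq0.
apply: contra_notT hA => /rowV0Pn[u /sub_kermxP uE u0].
exists u, (\sum_(i < n) u 0 i * (a ord0 0 i)%:~R); split=> // j.
case: (unliftP ord0 j) => [k ->|-> //].
apply/eqP; rewrite -subr_eq0 -sumrB; apply/eqP.
have /rowP/(_ k) := uE; rewrite !mxE => e0; apply: etrans e0.
apply: eq_bigr => i _.
by rewrite !mxE intrB mulrBr.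
Qed.

Lemma monomial_neq0 (F : fieldType) (n : nat) (x : 'rV[F]_n) k :
  in_torus x -> monomial x k != 0.
Proof.
move=> /forallP xT; apply/prodf_neq0 => i _; rewrite expfz_neq0 //.
by have := xT i; rewrite unitfE.
Qed.

Lemma solution_augment (R : realType) (n m : nat) (a : 'I_m.+1 -> 'rV[int]_n)
    (M : 'M[R]_(n, m)) (x : 'rV[R]_n) : in_torus x ->
  solution a (augment M) x <->
  M *m (\col_k (monomial x (differences a k) - 1)) = 0.
Proof.
move=> xT.
have key i : \sum_j augment M i j * monomial x (a j) =
    monomial x (a ord0) *
      (M *m (\col_k (monomial x (differences a k) - 1))) i 0.
  rewrite big_ord_recl augment_ord0 mulNr mulr_suml mxE mulr_sumr.
  rewrite -sumrN -big_split.
  apply: eq_bigr => k _; rewrite augment_lift [X in _ = _ * (_ * X)]mxE.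
  have -> : a (lift ord0 k) = a ord0 + differences a k by rewrite addrC subrK.
  by rewrite monomialD //=; ring.
split=> [h|h i]; last by rewrite key h mxE mulr0.
apply/colP => i; have /eqP := h i.
by rewrite key mulf_eq0 (negPf (monomial_neq0 _ xT)) => /eqP ->; rewrite mxE.
Qed.

Lemma positive_in_torus (R : realType) (n : nat) (x : 'rV[R]_n) :
  (forall i, 0 < x 0 i) -> in_torus x.
Proof. by move=> x0; apply/forallP => i; rewrite unitfE gt_eqF. Qed.

Lemma gen_ideal_mem (A : comNzRingType) (m : nat) (gen : 'I_m -> A) i :
  gen_ideal gen (gen i).
Proof.
exists (fun j => (j == i)%:R).
rewrite (bigD1 i) //= eqxx mul1r big1 ?addr0 // => j.
by move=> /negPf ->; rewrite mul0r.
Qed.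

Lemma ideal_sum (A : comNzRingType) (I : ideal A) (T : Type) (r : seq T)
    (f : T -> A) :
  (forall i, I (f i)) -> I (\sum_(i <- r) f i).
Proof.
by move=> If; elim/big_ind: _ => //; [exact: ideal0|exact: idealD].
Qed.

Section SystemIdeal.
Variables (R : realType) (n m : nat) (a : 'I_m.+1 -> 'rV[int]_n).
Variables (M : 'M[R]_(n, m)) (b : 'cV[R]_m) (w : 'rV[R]_m) (D : 'M[R]_(m, n)).
Hypothesis DM : D *m M = 1%:M - b *m w.

Local Notation A := (laurent n R[i]).
Local Notation I := (gen_ideal (system_poly a (augment M))).
Local Notation alpha := (differences a).

(** Modulo the ideal of the system this is the parameter t of the line of
    solutions 1 + t b of the linear system. *)
Definition coordinate : A :=
  \sum_k (w 0 k)%:C%C *: (term 1 (alpha k) - 1).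

(** Dividing an equation of the system by the unit x^(a_0) leaves a combination
    of the x^alpha_k - 1, because the coefficients sum to zero. *)
Lemma system_row_in_ideal i :
  I (\sum_k (M i k)%:C%C *: (term 1 (alpha k) - 1)).
Proof.
have -> : \sum_k (M i k)%:C%C *: (term 1 (alpha k) - 1) =
    term 1 (- a ord0) * system_poly a (augment M) i :> A.
  rewrite /system_poly big_ord_recl augment_ord0 mulrDr mulr_sumr.
  rewrite term_mul mul1r addNr rmorphN rmorph_sum /=.
  have -> : term (- \sum_k (M i k)%:C%C) 0 = \sum_k - (M i k)%:C%C *: 1 :> A.
    rewrite -scaler_suml sumrN -term1 termZ mulr1 //.
  rewrite -big_split; apply: eq_bigr => k _ /=.
  rewrite augment_lift term_mul mul1r scalerBr termZ mulr1 scaleNr.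
  by rewrite addrC [- a _ + _]addrC.
by apply: idealM; exact: gen_ideal_mem.
Qed.

(** The projector along b sends the vector of the x^alpha_k - 1 to the
    differences wanted; it factors through M, which sends that vector into the
    ideal. *)
Lemma coordinate_relation j :
  I (term 1 (alpha j) - (1 + (b j 0)%:C%C *: coordinate)).
Proof.
have -> : term 1 (alpha j) - (1 + (b j 0)%:C%C *: coordinate) =
    \sum_i (D j i)%:C%C%:A * \sum_k (M i k)%:C%C *: (term 1 (alpha k) - 1) :> A.
  under eq_bigr => i _ do rewrite mulr_algl scaler_sumr.
  rewrite exchange_big /=.
  transitivity (\sum_k ((j == k)%:R - b j 0 * w 0 k)%:C%C *:
      (term 1 (alpha k) - 1) : A).
    rewrite opprD addrA /coordinate scaler_sumr.
    under [in RHS]eq_bigr => k _ do rewrite rmorphB scalerBl rmorphM -scalerA.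
    rewrite sumrB; congr (_ - _).
    rewrite (bigD1 j) //= eqxx rmorph1 scale1r big1 ?addr0 // => k.
    by rewrite eq_sym => /negPf ->; rewrite rmorph0 scale0r.
  apply: eq_bigr => k _; under [RHS]eq_bigr => i _ do rewrite scalerA.
  rewrite -scaler_suml; congr (_ *: _).
  have /matrixP/(_ j k) := DM; rewrite !mxE big_ord1 => <-.
  by rewrite rmorph_sum; apply: eq_bigr => i _; rewrite rmorphM.
by apply: ideal_sum => i; apply: idealM; exact: system_row_in_ideal.
Qed.
End SystemIdeal.

(** * A curve of solutions makes the local ring infinite *)

Section ComplexPoint.
Variables (R : realType) (n : nat).

Lemma complex_point_in_torus (x : 'rV[R]_n) :
  in_torus x -> in_torus (complex_point x).
Proof.
move=> /forallP xT; apply/forallP => i; rewrite mxE unitfE fmorph_eq0 -unitfE.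
exact: xT.
Qed.

Lemma monomial_complex_point (x : 'rV[R]_n) k : in_torus x ->
  monomial (complex_point x) k = (monomial x k)%:C%C.
Proof.
move=> /forallP xT; rewrite /monomial rmorph_prod; apply: eq_bigr => i _.
by rewrite mxE rmorphXz.
Qed.

Lemma leval_system_ideal (N : nat) (a : 'I_N -> 'rV[int]_n) (C : 'M[R]_(n, N))
    (x : 'rV[R]_n) (xT : in_torus x) (xT' : in_torus (complex_point x)) f :
  solution a C x -> gen_ideal (system_poly a C) f -> leval xT' f = 0.
Proof.
move=> xC [h ->]; rewrite rmorph_sum big1 // => i _ /=.
rewrite rmorphM /= /system_poly rmorph_sum /=.
under [X in _ * X]eq_bigr => j _ do
  rewrite leval_term (monomial_complex_point _ xT) -rmorphM.
by rewrite -rmorph_sum xC rmorph0 mulr0.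
Qed.

Lemma real_combination_continuous (T : Type) (s : seq T) (c : T -> R)
    (g : T -> R -> R) :
  (forall k, {for 0, continuous (g k)}) ->
  {for 0, continuous (fun t => \sum_(k <- s) c k * g k t)}.
Proof.
move=> gc; elim: s => [|k s IH].
  have -> : (fun t => \sum_(k <- [::]) c k * g k t) = cst 0 :> (R -> R).
    by apply/funext => t; rewrite big_nil.
  exact: cvg_cst.
have -> : (fun t => \sum_(k <- k :: s) c k * g k t) =
    (fun t => c k * g k t + \sum_(k <- s) c k * g k t).
  by apply/funext => t; rewrite big_cons.
apply: (@cvgD _ _ _ _ _ (fun t => c k * g k t)
  (fun t => \sum_(k <- s) c k * g k t)) => //.
by apply: cvgM; [exact: cvg_cst|exact: gc].
Qed.

(** The real or the imaginary part is nonzero at 0, and both are continuous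
    real functions of t. *)
Lemma complex_combination_neq0 (T : Type) (s : seq T) (c : T -> R[i])
    (g : T -> R -> R) :
  (forall k, {for 0, continuous (g k)}) ->
  \sum_(k <- s) c k * (g k 0)%:C%C != 0 ->
  \forall t \near (0 : R), \sum_(k <- s) c k * (g k t)%:C%C != 0.
Proof.
move=> gc s0.
pose G t := \sum_(k <- s) c k * (g k t)%:C%C.
have ReE t : complex.Re (G t) = \sum_(k <- s) complex.Re (c k) * g k t.
  rewrite raddf_sum; apply: eq_bigr => k _.
  by case: (c k) => u v /=; rewrite mulr0 subr0.
have ImE t : complex.Im (G t) = \sum_(k <- s) complex.Im (c k) * g k t.
  rewrite raddf_sum; apply: eq_bigr => k _.
  by case: (c k) => u v /=; rewrite mulr0 add0r.
have : (complex.Re (G 0) != 0) || (complex.Im (G 0) != 0).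
  apply: contraNT s0; rewrite -/(G 0); rewrite negb_or !negbK => /andP[].
  by case: (G 0) => u v /= /eqP -> /eqP ->.
rewrite ReE ImE => /orP[] h0.
  have /cvgr_neq0 /(_ h0) := real_combination_continuous (s := s)
    (c := fun k => complex.Re (c k)) gc.
  by apply: filterS => t; apply: contra_neq => e; rewrite -ReE /G e.
have /cvgr_neq0 /(_ h0) := real_combination_continuous (s := s)
  (c := fun k => complex.Im (c k)) gc.
by apply: filterS => t; apply: contra_neq => e; rewrite -ImE /G e.
Qed.

Lemma near_right_zeros (q : {poly R[i]}) :
  (\forall t \near (0 : R)^'+, q.[t%:C%C] = 0) -> q = 0.
Proof.
move=> /nbhs_ballP[d /= d0 dq]; apply/eqP; apply: contraT => q0.
pose rs := [seq (d / i.+2%:R)%:C%C | i <- iota 0 (size q)].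
have : (size rs < size q)%N.
  apply: max_poly_roots q0 _ _.
    apply/allP => _ /mapP[i _ ->]; rewrite rootE; apply/eqP/dq.
      rewrite /ball /= sub0r normrN gtr0_norm ?divr_gt0 //.
      by rewrite ltr_pdivrMr // ltr_pMr // ltr1n.
    by rewrite divr_gt0.
  rewrite map_inj_uniq ?iota_uniq // => i j.
  move=> /(@complexI _) /(mulfI (lt0r_neq0 d0)).
  by move=> /invr_inj /eqP; rewrite eqr_nat => /eqP[].
by rewrite size_map size_iota ltnn.
Qed.
End ComplexPoint.

Section Curve.
Variables (R : realType) (n : nat) (a : 'I_n.+2 -> 'rV[int]_n).
Variables (M : 'M[R]_(n, n.+1)) (b : 'cV[R]_n.+1) (w : 'rV[R]_n.+1).
Hypothesis Mb : M *m b = 0.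
Hypothesis wb : w *m b = 1%:M.
Variable lam : 'I_n.+1 -> int.
Local Notation alpha := (differences a).
Hypothesis rkE : \rank (exponent_mx R alpha) = n.
Hypothesis lam_neq0 : exists j, lam j != 0.
Hypothesis lam_rel : \sum_j alpha j *~ lam j = 0.
Local Notation I := (gen_ideal (system_poly a (augment M))).
Local Notation node := (fun j => b j 0).
Local Notation pt := (curve_point alpha node).

Lemma curve_point_continuous k :
  {for 0, continuous (fun t => monomial (pt t) k)}.
Proof.
have -> : (fun t => monomial (pt t) k) =
    (fun t => expR (\sum_i (k 0 i)%:~R * log_point alpha node t i)).
  apply/funext => t; rewrite monomial_exp; congr expR.
  by apply: eq_bigr => i _; rewrite mulrC.
apply: (@continuous_comp _ _ _
  (fun t => \sum_i (k 0 i)%:~R * log_point alpha node t i) expR);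
  last exact: continuous_expR.
apply: real_combination_continuous => i.
apply: real_combination_continuous => j.
apply/differentiable_continuous/derivable1_diffP.
have h : 0 < 1 + 0 * b j 0 by rewrite mul0r addr0.
by have [] := is_derive_ln1 h.
Qed.

Lemma curve_point0 : pt 0 = const_mx 1.
Proof.
apply/rowP => i; rewrite !mxE /log_point big1 ?expR0 // => j _.
by rewrite mul0r addr0 ln1 mulr0.
Qed.

(** If g vanishes identically, every small t gives a real solution on which the
    coordinate takes the value t.  A relation v q(y) in the ideal, with v
    nonzero at 1, is then evaluated along this curve: v stays nonzero near 1, so
    q has infinitely many roots. *)
Lemma curve_infinite_dimension
    (xT : in_torus (complex_point (const_mx 1 : 'rV[R]_n))) d :
  (forall t, log_domain node t -> log_sum (real_weights R lam) node t = 0) ->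
  ~ has_dimension (local_quotient I (leval xT)) d.
Proof.
move=> g0 dimL.
have [q q0 [v v0 Iv]] := dimension_relation (coordinate a w) dimL.
move/eqP: q0; apply; apply: near_right_zeros.
have ptT t : in_torus (pt t).
  by apply: positive_in_torus => i; exact: curve_point_gt0.
have vE t (xT' : in_torus (complex_point (pt t))) :
    leval xT' v = \sum_(k <- finsupp v) lcoef k v * (monomial (pt t) k)%:C%C.
  by rewrite /leval; apply: eq_bigr => k _; rewrite monomial_complex_point.
have nv : \forall t \near (0 : R)^'+,
    \sum_(k <- finsupp v) lcoef k v * (monomial (pt t) k)%:C%C != 0.
  apply/near_right/complex_combination_neq0.
    exact: curve_point_continuous.
  rewrite -(vE 0 (complex_point_in_torus (ptT 0))) /leval.
  by move: v0; rewrite /= /leval curve_point0.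
have nd : \forall t \near (0 : R)^'+, log_domain node t.
  have := near_log_domain (fun j => (b j 0)%:P) (@ltr01 R).
  apply: filter_app; near=> t => h.
  have t0 : 0 < t by near: t; exact: nbhs_right_gt.
  have := h t; rewrite gtr0_norm // mulr1 => /(_ (lexx _)) tb j.
  by have := tb j; rewrite hornerC.
near=> t.
have tb : log_domain node t by near: t.
have monE j : monomial (pt t) (alpha j) = 1 + t * b j 0.
  exact: (monomial_curve_point rkE lam_neq0 lam_rel j tb (g0 t tb)).
have tT := complex_point_in_torus (ptT t).
have sol : solution a (augment M) (pt t).
  apply/(solution_augment _ _ (ptT t)).
  have -> : \col_k (monomial (pt t) (alpha k) - 1) = t *: b.
    by apply/colP => k; rewrite !mxE monE addrC addKr.
  by rewrite -scalemxAr Mb scaler0.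
have := leval_system_ideal (ptT t) tT sol Iv.
have yE : leval tT (coordinate a w) = t%:C%C.
  rewrite /coordinate rmorph_sum /=.
  under eq_bigr => k _ do rewrite leval_scale rmorphB rmorph1 /=
    leval_term mul1r (monomial_complex_point _ (ptT t)) monE rmorphD
    rmorph1 addrC addKr -rmorphM mulrCA.
  rewrite -rmorph_sum -mulr_sumr; congr _%:C%C.
  have /matrixP/(_ 0 0) := wb; rewrite !mxE eqxx => ->.
  by rewrite mulr1.
rewrite rmorphM rmorph_sum /= => /eqP; rewrite mulf_eq0 => /orP[/eqP e|/eqP e].
  have : \sum_(k <- finsupp v) lcoef k v * (monomial (pt t) k)%:C%C != 0.
    by near: t.
  by rewrite -(vE t tT) e eqxx.
rewrite horner_coef -[RHS]e; apply: eq_bigr => i _.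
by rewrite leval_scale rmorphXn /= yE.
Unshelve. all: by end_near. Qed.
End Curve.

(** * The perturbation *)

Definition pos_part (z : int) : nat := if z is Posz m then m else 0.
Definition neg_part (z : int) : nat := if z is Negz m then m.+1 else 0.

Lemma pos_neg_part (F : pzRingType) (z : int) :
  (pos_part z)%:R - (neg_part z)%:R = z%:~R :> F.
Proof.
case: z => m /=; first by rewrite subr0.
by rewrite NegzE sub0r mulrNz.
Qed.

Lemma pos_neg_part_mulrz (V : zmodType) (v : V) (z : int) :
  v *+ pos_part z - v *+ neg_part z = v *~ z.
Proof.
case: z => m /=; first by rewrite mulr0n subr0.
by rewrite NegzE mulr0n sub0r mulrNz.
Qed.

Section Assembly.
Variables (R : realType) (n : nat) (a : 'I_n.+2 -> 'rV[int]_n).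
Local Notation alpha := (differences a).
Variable lam : 'I_n.+1 -> int.
Hypothesis rkE : \rank (exponent_mx R alpha) = n.
Hypothesis lam_neq0 : exists j, lam j != 0.
Hypothesis lam_rel : \sum_j alpha j *~ lam j = 0.
Local Notation l := (real_weights R lam).

Section Base.
Variables (M : 'M[R]_(n, n.+1)) (b : 'cV[R]_n.+1) (w : 'rV[R]_n.+1).
Variable D : 'M[R]_(n.+1, n).
Hypothesis Mb : M *m b = 0.
Hypothesis wb : w *m b = 1%:M.
Hypothesis DM : D *m M = 1%:M - b *m w.
Hypothesis hmult : has_multiplicity a (augment M) (const_mx 1) n.+1.
Local Notation node := (fun j => b j 0).

Lemma power_sums_vanish k : (k < n)%N -> power_sum l node k.+1 = 0.
Proof.
have [xT dimL] := hmult.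
have x1 : complex_point (const_mx 1 : 'rV[R]_n) = const_mx 1.
  by apply/rowP => i; rewrite !mxE rmorph1.
have y0 : leval xT (coordinate a w) = 0.
  rewrite /coordinate rmorph_sum big1 // => i _ /=.
  rewrite leval_scale rmorphB rmorph1 /= leval_term (monomial_one x1).
  by rewrite mulr1 subrr mulr0.
have span i := integer_span i (rank_exponent_rat rkE).
have rel : \sum_j alpha j *+ pos_part (lam j) =
    \sum_j alpha j *+ neg_part (lam j).
  apply/eqP; rewrite -subr_eq0 -sumrB -[X in _ == X]lam_rel; apply/eqP.
  by apply: eq_bigr => j _; rewrite pos_neg_part_mulrz.
have := order_of_multiplicity x1 (coordinate_relation a DM) y0 span rel dimL.
move=> /power_sum_of_order h kn; have := h k kn.
move=> e; apply: (@complexI R); rewrite rmorph0 -[RHS]e rmorph_sum.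
apply: eq_bigr => j _; rewrite rmorphM rmorphXn /= pos_neg_part.
by rewrite /real_weights rmorph_int.
Qed.

(** Otherwise the first n+1 power sums vanish, so g has zero derivative and the
    whole curve consists of solutions. *)
Lemma power_sum_last_neq0 : power_sum l node n.+1 != 0.
Proof.
have [xT dimL] := hmult.
apply/eqP => pn.
have p0 k : (k < n.+1)%N -> power_sum l node k.+1 = 0.
  rewrite ltnS leq_eqVlt => /predU1P[->//|]; exact: power_sums_vanish.
apply: (curve_infinite_dimension Mb wb rkE lam_neq0 lam_rel _ dimL) => t tb.
have d0 u : log_domain node u -> \sum_j l j * b j 0 / (1 + u * b j 0) = 0.
  by move=> ub; apply: log_derivative_eq0 => // j; rewrite lt0r_neq0.
have [t0|t0|->] := ltgtP t 0; last exact: log_sum0.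
  have [u [_ ub]] := log_sum_mvt l t0 tb (@log_domain0 _ _ _).
  by rewrite d0 // mul0r log_sum0 sub0r => /eqP; rewrite oppr_eq0 => /eqP.
have [u [_ ub]] := log_sum_mvt l t0 (@log_domain0 _ _ _) tb.
by rewrite d0 // mul0r log_sum0 subr0.
Qed.
End Base.

Lemma positive_solutions_curve (M : 'M[R]_(n, n.+1)) (beta : 'I_n.+1 -> R) :
  (forall v : 'cV[R]_n.+1, M *m v = 0 <-> exists t, v = t *: \col_j beta j) ->
  positive_solutions a (augment M) =
  curve_point alpha beta @`
    [set t | log_domain beta t /\ log_sum l beta t = 0].
Proof.
move=> kerM; apply/seteqP; split=> x /=.
  move=> [x0 /(solution_augment _ _ (positive_in_torus x0)) /kerM [t tE]].
  have xt j : monomial x (alpha j) = 1 + t * beta j.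
    have /colP/(_ j) := tE; rewrite !mxE => /eqP.
    by rewrite subr_eq addrC => /eqP.
  have [tb t0 xE] := positive_monomials rkE lam_rel x0 xt.
  by exists t.
move=> [t [tb t0] <-]; split=> [i|]; first exact: curve_point_gt0.
apply/solution_augment.
  by apply: positive_in_torus => i; exact: curve_point_gt0.
apply/kerM; exists t; apply/colP => j; rewrite !mxE.
by rewrite (monomial_curve_point rkE lam_neq0 lam_rel) // addrC addKr.
Qed.

(** The entries are polynomials in e, hence continuous. *)
Lemma near_augment_tilt (M : 'M[R]_(n, n.+1)) (w : 'rV[R]_n.+1)
    (B : 'I_n.+1 -> {poly R}) (U : set 'M[R]_(n, n.+2)) :
  nbhs (augment (tilt M w (\col_j (B j).[0]))) U ->
  \forall e \near (0 : R)^'+, U (augment (tilt M w (\col_j (B j).[e]))).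
Proof.
move=> /nbhs_ballP[r /= r0 rU].
pose q i k : {poly R} := (\sum_j (w 0 j)%:P * B j) * (M i k)%:P -
  (\sum_j (M i j)%:P * B j) * (w 0 k)%:P.
have qE i k e : (q i k).[e] = tilt M w (\col_j (B j).[e]) i k.
  rewrite /q hornerD hornerN !hornerM !hornerC !horner_sum !mxE big_ord1 !mxE.
  congr (_ * _ - _ * _); apply: eq_bigr => j _;
  by rewrite hornerM hornerC !mxE.
have [p pE] : exists p : 'I_n -> 'I_n.+2 -> {poly R},
    forall i j e, (p i j).[e] = augment (tilt M w (\col_j (B j).[e])) i j.
  exists (fun i j => if unlift ord0 j is Some k then q i k else - \sum_k q i k).
  move=> i j e; rewrite [RHS]mxE; case: unlift => [k|]; first exact: qE.
  by rewrite hornerN horner_sum; congr (- _); apply: eq_bigr => k _; exact: qE.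
have : \forall e \near (0 : R)^'+, forall ij : 'I_n * 'I_n.+2,
    ball ((p ij.1 ij.2).[0]) r ((p ij.1 ij.2).[e]).
  apply: filter_forall => -[i j] /=; apply: near_right.
  by have /cvg_ball /(_ _ r0) := @continuous_horner R (p i j) 0.
apply: filterS => e h; apply: rU; split=> // i j.
by rewrite -!pE; exact: (h (i, j)).
Qed.

End Assembly.

Theorem proposition8p5 (R : realType) (n : nat) (hn : (1 <= n)%N)
    (a : 'I_n.+2 -> 'rV[int]_n) (ha : injective a)
    (hA : ~ in_affine_hyperplane R a)
    (C : 'M[R]_(n, n.+2)) (hC : \rank C = n)
    (hsol : solution a C (const_mx 1))
    (hmult : has_multiplicity a C (const_mx 1) n.+1) :
  forall U : set 'M[R]_(n, n.+2), nbhs C U ->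
  exists2 C' : 'M[R]_(n, n.+2), U C' &
    (positive_solutions a C' #= `I_n.+1)%card.
Proof.
move=> U CU.
have [M CM] : exists M, C = augment M.
  exists (col' ord0 C); apply: augment_col' => i.
  rewrite -[RHS](hsol i); apply: eq_bigr => j _.
  rewrite /monomial big1 ?mulr1 // => k _; by rewrite mxE exp1rz.
subst C.
have rM : \rank M = n.
  by apply/eqP; rewrite eqn_leq rank_leq_row -{1}hC rank_augment.
have [b [w [D [Mb wb DM]]]] := kernel_line rM.
have rkE := rank_differences hA.
have [lam lam0 rel] := integer_relation (differences a).
pose l := real_weights R lam.
have p0 := power_sums_vanish rkE rel DM hmult.
have pn := power_sum_last_neq0 rkE lam0 rel Mb wb DM hmult.
have [binj lb0] := nodes_nondegenerate p0 pn.
(* This is the leading coefficient for which the target of the last power sum,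
   a constant, equals its value at the unperturbed nodes. *)
pose kappa : R := (-1) ^+ n * power_sum l (fun j => b j 0) n.+1 / n.+1%:R.
have k0 : kappa != 0.
  by rewrite /kappa !mulf_neq0 ?signr_eq0 ?invr_eq0 ?pnatr_eq0.
have T0 k : (k < n.+1)%N ->
    (power_sum_target n (nat_root_poly kappa n) k).[0] =
    power_sum l (fun j => b j 0) k.+1.
  rewrite hornerZ hornerXn expr0n subn_eq0 ltnS leq_eqVlt => /predU1P[->|kn].
    rewrite leqnn mulr1 nat_root_poly_lead /kappa [n.+1%:R * _]mulrC.
    by rewrite divfK ?pnatr_eq0 // mulrA -exprMn mulrNN mulr1 expr1n mul1r.
  by rewrite leqNgt kn mulr0 p0.
have l0 j : l j != 0 by have /andP[] := lb0 j.
have [B [B0 BT]] := lift_power_sums n.+1 binj l0 T0.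
have b0E : b = \col_j (B j).[0] by apply/colP => j; rewrite mxE B0.
have near_neq0 (p : {poly R}) :
    p.[0] != 0 -> \forall e \near (0 : R)^'+, p.[e] != 0.
  move=> h; apply: near_right.
  by have /cvgr_neq0 /(_ h) := @continuous_horner R p 0.
pose wB : {poly R} := \sum_j (w 0 j)%:P * B j.
have wBE e : wB.[e] = (w *m \col_j (B j).[e]) 0 0.
  rewrite mxE horner_sum; apply: eq_bigr => j _.
  by rewrite hornerM hornerC mxE.
have CU' : nbhs (augment (tilt M w (\col_j (B j).[0]))) U.
  by rewrite -b0E tilt_base.
near (0 : R)^'+ => e.
have we : (w *m \col_j (B j).[e]) 0 0 != 0.
  rewrite -wBE; near: e; apply: near_neq0.
  by rewrite wBE -b0E wb mxE oner_eq0.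
have Be : (B ord0).[e] != 0.
  by near: e; apply: near_neq0; rewrite B0; have /andP[] := lb0 ord0.
exists (augment (tilt M w (\col_j (B j).[e]))).
  by near: e; exact: near_augment_tilt.
rewrite (positive_solutions_curve rkE lam0 rel
  (beta := fun j => (B j).[e])); last first.
  by move=> v; exact: tilt_kernel Mb wb DM we.
have cardZ : ([set t | log_domain (fun j => (B j).[e]) t /\
    log_sum l (fun j => (B j).[e]) t = 0] #= `I_n.+1)%card.
  by near: e; exact: near_log_sum_count k0 BT.
apply: card_eq_trans cardZ.
exact/inj_card_eq/(curve_point_inj rkE lam0 rel Be).
Unshelve. all: by end_near. Qed.
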